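(* Let $I\subset\{1,\dots,n\}$ have cardinality $2k+2$ with $k\ge0$, and fix $\mu\in\mathfrak C_I$. Then a quasi-parabolic bundle $(E_1,\mathbf p)$ is not $\mu$-semistable if and only if there exist a line bundle $L$ of degree $\deg L=-k$ and a nonzero morphism $L\to E_1$ whose image passes through $p_j$ for all $j\in I$.
   Context: $C$ is a complex elliptic curve with origin $w_\infty$, and $D=t_1+\dots+t_n$ is a reduced divisor on $C$. $E_1$ is the unique non-trivial extension $0\to\mathcal O_C\to E_1\to\mathcal O_C(w_\infty)\to0$. A quasi-parabolic bundle $(E,\mathbf p)$ on $(C,D)$ is a rank $2$ bundle $E$ with lines $p_k\subset E_{t_k}$, $k=1,\dots,n$. For $\mu\in(0,1)^n$ and a line subbundle $L\subset E$ put $\mathrm{Stab}_\mu(L)=\deg E-2\deg L+\sum_{p_k\ne L_{t_k}}\mu_k-\sum_{p_k=L_{t_k}}\mu_k$; $(E,\mathbf p)$ is $\mu$-semistable if $\mathrm{Stab}_\mu(L)\ge0$ for every line subbundle $L\subset E$. For $I\subset\{1,\dots,n\}$ of even cardinality, $\mathfrak C_I=\{\mu\in(0,1)^n\mid\sum_{k\notin I}\mu_k-\sum_{k\in I}\mu_k+|I|<1\}$. The image of a morphism $\phi\colon L\to E$ from a line bundle (not necessarily a subbundle inclusion) passes through $p_j\subset E_{t_j}$ if $\phi_{t_j}(L_{t_j})\subset p_j$; in particular this holds if $\phi$ vanishes at $t_j$. *)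

(* Defs.v *)
(* The curve is a smooth Weierstrass cubic with its point at infinity as origin;
   the base field k is R[i] in all applications.  Vector bundles are algebraic,
   given by Zariski-local trivialisations and transition matrices; as the curve
   is integral, all transition functions are taken in its function field. *)
From HB Require Import structures.
From mathcomp Require Import all_boot all_order all_algebra all_field.
From mathcomp Require Import boolp classical_sets cardinality fsbigop reals.
From mathcomp Require Import complex.

Set Implicit Arguments.
Unset Strict Implicit.
Unset Printing Implicit Defensive.

Import Order.TTheory GRing.Theory Num.Theory.
Local Open Scope classical_set_scope.
Local Open Scope ring_scope.

Lemma fraction_repr (A : idomainType) (f : {fraction A}) :
  exists n d : A, d != 0 /\ f * tofrac d = tofrac n.
Proof.
elim/quotW: f => r; exists \n_r, \d_r; split; first exact: denom_ratioP.
unlock FracField.tofrac.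
rewrite -[LHS]FracField.pi_mul; apply/eqmodP.
by rewrite /= FracField.equivfE /FracField.mulf !numden_Ratio
  ?(oner_neq0, mulf_neq0, denom_ratioP) //= !mulr1 mulrC.
Qed.

Lemma irreducible_sqr_sub (F : fieldType) (f : {poly F}) :
  odd (size f).-1 -> monic_irreducible_poly ('X^2 - (tofrac f)%:P).
Proof.
move=> oddf; have f0 : f != 0.
  by apply: contraTneq oddf => ->; rewrite size_poly0.
have sz1 : (size (- (tofrac f)%:P) < 3)%N.
  by rewrite size_polyN size_polyC; case: eqP.
have sz : size ('X^2 - (tofrac f)%:P) = 3%N by rewrite size_polyDl size_polyXn.
split; last by rewrite monicE lead_coefDl ?lead_coefXn // size_polyXn.
apply: cubic_irreducible => [|q]; first by rewrite sz.
apply/negP; rewrite /root !hornerE subr_eq0 => /eqP q2.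
have [n [d [d0 qd]]] := fraction_repr q.
have nd : n ^+ 2 = f * d ^+ 2.
  apply/eqP; rewrite -tofrac_eq !expr2 !rmorphM /= -qd.
  by rewrite mulrACA -[q * q]expr2 q2.
have n0 : n != 0 by rewrite -sqrf_eq0 nd mulf_neq0 // sqrf_eq0.
have even_sq (p : {poly F}) : odd (size (p ^+ 2)).-1 = false.
  by rewrite size_exp muln2 odd_double.
have odd_predD a b : (0 < a -> 0 < b ->
    odd (a + b).-1.-1 = odd a.-1 (+) odd b.-1)%N.
  by case: a b => [|a] [|b] // _ _; rewrite addSn addnS oddD.
have := even_sq n; rewrite nd size_mul ?sqrf_eq0 //.
by rewrite odd_predD ?size_poly_gt0 ?sqrf_eq0 // even_sq oddf.
Qed.

(* p(u, v), where p is a polynomial in an inner variable evaluated at u and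
   an outer variable evaluated at v *)
Definition eval2 (A B : comNzRingType) (h : {rmorphism A -> B})
    (p : {poly {poly A}}) (u v : B) : B :=
  (map_poly (horner_eval u \o map_poly h) p).[v].

Section QuotientField.
Variables (F : fieldType) (h : {poly F}) (hI : monic_irreducible_poly h).

Definition to_qfpoly (p : {poly F}) : {poly %/ h with hI} := in_qpoly h p.

Lemma to_qfpoly_zmod_morphism : zmod_morphism to_qfpoly.
Proof. exact: (rmorphB (in_qpoly h)). Qed.
HB.instance Definition _ := GRing.isZmodMorphism.Build
  {poly F} {poly %/ h with hI} to_qfpoly to_qfpoly_zmod_morphism.

Lemma to_qfpoly_monoid_morphism : monoid_morphism to_qfpoly.
Proof. exact: in_qpoly_monoid_morphism. Qed.
HB.instance Definition _ := GRing.isMonoidMorphism.Build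
  {poly F} {poly %/ h with hI} to_qfpoly to_qfpoly_monoid_morphism.
End QuotientField.

(* short Weierstrass form; only used in characteristic 0 *)
Record elliptic_curve (k : closedFieldType) := EllipticCurve {
  coef_a : k;
  coef_b : k;
  discriminant_neq0 : 4 * coef_a ^+ 3 + 27 * coef_b ^+ 2 != 0
}.

Section Curve.
Variables (k : closedFieldType) (C : elliptic_curve k).

Definition cubic : {poly k} := 'X^3 + coef_a C *: 'X + (coef_b C)%:P.

(* None is the point at infinity [0 : 1 : 0] *)
Definition on_curve (P : option (k * k)) : bool :=
  if P is Some (x, y) then y ^+ 2 == cubic.[x] else true.

Definition curve_point := {P : option (k * k) | on_curve P}.

Definition origin : curve_point := exist _ None isT.

Lemma size_cubic : size cubic = 4%N.
Proof.
rewrite /cubic -addrA size_polyDl size_polyXn //.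
rewrite (leq_ltn_trans (size_polyD _ _)) // gtn_max size_polyC.
by rewrite (leq_ltn_trans (size_scale_leq _ _)) ?size_polyX //; case: eqP.
Qed.

(* Y^2 - (x^3 + a x + b) over the field k(x) *)
Definition weierstrass_poly : {poly {fraction {poly k}}} :=
  'X^2 - (tofrac cubic)%:P.

Lemma weierstrass_poly_irreducible : monic_irreducible_poly weierstrass_poly.
Proof. by apply: irreducible_sqr_sub; rewrite size_cubic. Qed.

Lemma size_weierstrass_poly : size weierstrass_poly = 3%N.
Proof.
by rewrite size_polyDl size_polyXn // size_polyN size_polyC; case: eqP.
Qed.

(* k(x)[y] / (y^2 - x^3 - a x - b) *)
Definition function_field : fieldType :=
  {poly %/ weierstrass_poly with weierstrass_poly_irreducible}.

Definition constant : {rmorphism k -> function_field} :=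
  to_qfpoly weierstrass_poly_irreducible \o polyC \o @tofrac _ \o polyC.
Definition xfun : function_field :=
  to_qfpoly weierstrass_poly_irreducible (tofrac 'X)%:P.
Definition yfun : function_field := to_qfpoly weierstrass_poly_irreducible 'X.

(* Affine coordinates around a point: (x, y) away from infinity, and
   (x / y, 1 / y) at infinity, both as rational functions and as numbers. *)
Definition coord_fun (P : curve_point) : function_field * function_field :=
  if val P is Some _ then (xfun, yfun) else (xfun / yfun, yfun^-1).
Definition coord_val (P : curve_point) : k * k := odflt (0, 0) (val P).

Definition poly_fun (P : curve_point) (p : {poly {poly k}}) : function_field :=
  eval2 constant p (coord_fun P).1 (coord_fun P).2.
Definition poly_val (P : curve_point) (p : {poly {poly k}}) : k :=
  eval2 idfun p (coord_val P).1 (coord_val P).2.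

(* membership in the local ring at P *)
Definition regular_at (P : curve_point) (f : function_field) : Prop :=
  exists p q, poly_val P q != 0 /\ f = poly_fun P p / poly_fun P q.

(* f(P), for f regular at P *)
Definition value_at (P : curve_point) (f : function_field) : k :=
  xget 0 [set c | exists p q, [/\ poly_val P q != 0,
    f = poly_fun P p / poly_fun P q & c = poly_val P p / poly_val P q]].

(* a generator of the maximal ideal of the local ring at P *)
Definition uniformizer (P : curve_point) (z : function_field) : Prop :=
  [/\ regular_at P z, value_at P z = 0 &
      forall f, regular_at P f -> value_at P f = 0 ->
        exists2 g, regular_at P g & f = z * g].

(* the order of vanishing of f at P, for f != 0 *)
Definition ord_at (P : curve_point) (f : function_field) : int :=
  xget 0 [set n : int | exists z u, [/\ uniformizer P z, regular_at P u,
    value_at P u != 0 & f = u * z ^ n]].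

Definition regular_mx_at (P : curve_point) m n
    (A : 'M[function_field]_(m, n)) :=
  forall i j, regular_at P (A i j).
Definition value_mx_at (P : curve_point) m n
    (A : 'M[function_field]_(m, n)) :
  'M[k]_(m, n) := map_mx (value_at P) A.

(* A vector bundle of rank r.  The nonempty Zariski-open subsets of the curve
   are the sets with finite complement.  A section is given by columns s_i, one
   for each chart i, with s_i = trans i j *m s_j.  The field chart_at selects
   a chart around each point P; the fibre at P is identified with 'cV[k]_r
   by means of that chart. *)
Record bundle (r : nat) := Bundle {
  chart : Type;
  dom : chart -> set curve_point;
  chart_at : curve_point -> chart;
  trans : chart -> chart -> 'M[function_field]_r;
  dom_open : forall i, finite_set (~` dom i);
  dom_chart_at : forall P, dom (chart_at P) P;
  trans_regular : forall i j P, dom i P -> dom j P ->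
    regular_mx_at P (trans i j);
  trans_id : forall i, trans i i = 1%:M;
  trans_cocycle : forall i j l, trans i j *m trans j l = trans i l
}.

(* The degree of E is the degree of its determinant line bundle, computed from
   the rational section of det E equal to 1 in the chart at the origin. *)
Definition degree r (E : bundle r) : int :=
  \sum_(P \in [set: curve_point])
    ord_at P (\det (trans (chart_at E P) (chart_at E origin))).

Record bundle_mor r s (E : bundle r) (F : bundle s) := Morphism {
  mor_mx : chart F -> chart E -> 'M[function_field]_(s, r);
  mor_regular : forall j i P, dom j P -> dom i P ->
    regular_mx_at P (mor_mx j i);
  mor_trans : forall j' j i i',
    trans j' j *m mor_mx j i *m trans i i' = mor_mx j' i'
}.

Definition nonzero_mor r s (E : bundle r) (F : bundle s) (f : bundle_mor E F) :=
  exists j i, mor_mx f j i != 0.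

(* the linear map induced on the fibres at P *)
Definition fibre_mor r s (E : bundle r) (F : bundle s) (f : bundle_mor E F)
    (P : curve_point) : 'M[k]_(s, r) :=
  value_mx_at P (mor_mx f (chart_at F P) (chart_at E P)).

(* Exactness of 0 -> E' -> E -> E'' -> 0; for vector bundles it can be tested on
   fibres. *)
Definition short_exact r' r r'' (E' : bundle r') (E : bundle r)
    (E'' : bundle r'') (f : bundle_mor E' E) (g : bundle_mor E E'') : Prop :=
  forall P : curve_point,
  [/\ forall u : 'cV_r', fibre_mor f P *m u = 0 -> u = 0,
      forall v : 'cV_r, fibre_mor g P *m v = 0 <->
        exists u : 'cV_r', v = fibre_mor f P *m u &
      forall w : 'cV_r'', exists v : 'cV_r, w = fibre_mor g P *m v].

(* g has a right inverse: g \o h is the identity of F, whose matrices are the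
   transition matrices *)
Definition splits r s (E : bundle r) (F : bundle s) (g : bundle_mor E F) :=
  exists h : bundle_mor F E,
    forall j i j', mor_mx g j i *m mor_mx h i j' = trans j j'.

Lemma poly_funX P : poly_fun P 'X%:P = (coord_fun P).1.
Proof.
by rewrite /poly_fun /eval2 map_polyC hornerC /= map_polyX /horner_eval hornerX.
Qed.

Lemma poly_funY P : poly_fun P 'X = (coord_fun P).2.
Proof. by rewrite /poly_fun /eval2 map_polyX hornerX. Qed.

Lemma poly_valX P : poly_val P 'X%:P = (coord_val P).1.
Proof.
by rewrite /poly_val /eval2 map_polyC hornerC /= map_polyX /horner_eval hornerX.
Qed.

Lemma poly_valY P : poly_val P 'X = (coord_val P).2.
Proof. by rewrite /poly_val /eval2 map_polyX hornerX. Qed.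

Lemma regular_at1 P : regular_at P 1.
Proof.
exists 1, 1; rewrite /poly_fun /poly_val /eval2 !rmorph1 !hornerC.
by rewrite oner_neq0 divr1.
Qed.

Lemma xfun_neq0 : xfun != 0.
Proof.
rewrite (fmorph_eq0 (to_qfpoly weierstrass_poly_irreducible \o polyC)).
by rewrite tofrac_eq0 polyX_eq0.
Qed.

Lemma yfun_neq0 : yfun != 0.
Proof.
have szX : (size ('X : {poly {fraction {poly k}}}) <
    size (mk_monic weierstrass_poly))%N.
  rewrite mk_monicE; last exact: weierstrass_poly_irreducible.
  by rewrite size_polyX size_weierstrass_poly.
apply/eqP => y0; have /eqP := etrans (esym (in_qpoly_small szX))
  (congr1 (fun q : {poly %/ weierstrass_poly} => val q) y0).
by rewrite polyX_eq0.
Qed.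

Definition affine_part : set curve_point := [set P | P != origin].
(* x / y is a uniformizer at the origin, without other zeros or poles here *)
Definition origin_chart : set curve_point :=
  [set P | forall x y, val P = Some (x, y) -> x != 0 /\ y != 0].

Lemma affine_part_open : finite_set (~` affine_part).
Proof.
apply: (sub_finite_set _ (finite_set1 origin)) => P /=.
by move=> /negP; rewrite negbK => /eqP.
Qed.

Lemma origin_chart_open : finite_set (~` origin_chart).
Proof.
have [rs rsE] := closed_field_poly_normal cubic.
have [ss ssE] := closed_field_poly_normal ('X^2 - (cubic.[0])%:P : {poly k}).
pose s := [seq Some (x, 0) | x <- rs] ++ [seq Some (0, y) | y <- ss].
have c0 : cubic != 0 by rewrite -size_poly_eq0 size_cubic.
apply: (sub_finite_set _ (finite_seq (pmap insub s : seq curve_point))).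
move=> P /= nP.
rewrite mem_pmap_sub /s mem_cat.
apply: contrapT => /negP; rewrite negb_or => /andP[nx ny]; apply: nP => x y Pxy.
move: (valP P); rewrite Pxy /= => /eqP Cxy.
split; apply/eqP => z0; subst.
- move/negP: ny; apply; rewrite Pxy; apply/mapP; exists y => //.
  rewrite -root_prod_XsubC -(rootZ _ _ (a := lead_coef ('X^2 - (cubic.[0])%:P))).
    by rewrite -ssE /root hornerD hornerN hornerXn hornerC Cxy subrr.
  rewrite lead_coef_eq0 -size_poly_eq0 size_polyDl size_polyXn //.
  by rewrite size_polyN size_polyC; case: eqP.
- move/negP: nx; apply; rewrite Pxy; apply/mapP; exists x => //.
  rewrite -root_prod_XsubC -(rootZ _ _ (a := lead_coef cubic)) ?lead_coef_eq0 //.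
  by rewrite -rsE /root -Cxy expr0n.
Qed.

(* the trivial line bundle O *)
Definition trivial_line : bundle 1.
Proof.
refine (@Bundle 1 unit (fun=> setT) (fun=> tt) (fun _ _ => 1%:M) _ _ _ _ _).
- by move=> _; rewrite classical_sets.setCT; exact: finite_set0.
- by [].
- by move=> _ _ P _ _ i j; rewrite !ord1 mxE eqxx; exact: regular_at1.
- by [].
- by move=> _ _ _; rewrite mulmx1.
Defined.

(* The line bundle O(w), w the origin, as the subsheaf of the constant sheaf of
   rational functions generated by 1 on affine_part (the chart false) and by
   y / x on origin_chart (the chart true). *)
Definition origin_generator (c : bool) : function_field :=
  if c then yfun / xfun else 1.

Lemma origin_generator_neq0 c : origin_generator c != 0.
Proof.
by case: c; rewrite /= ?oner_neq0 ?mulf_neq0 ?invr_eq0 ?xfun_neq0 ?yfun_neq0.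
Qed.

Definition origin_dom (c : bool) := if c then origin_chart else affine_part.

Lemma origin_generator_regular c d P : origin_dom c P -> origin_dom d P ->
  regular_at P (origin_generator d / origin_generator c).
Proof.
have [<-|cd] := eqVneq c d.
  by rewrite divff ?origin_generator_neq0 // => _ _; exact: regular_at1.
have aff : affine_part P -> origin_chart P ->
    regular_at P (yfun / xfun) /\ regular_at P (yfun / xfun)^-1.
  case: P => -[[x y]|] Cxy //= _ /(_ x y erefl)[x0 y0].
  set P := exist _ _ _; split.
    by exists 'X, 'X%:P; rewrite poly_valX poly_funX poly_funY.
  by exists 'X%:P, 'X; rewrite invf_div poly_valY poly_funX poly_funY.
by case: c d cd => [] [] //= _ dP eP; rewrite ?mul1r ?divr1;
  have [] := aff _ _.
Qed.

Definition origin_line : bundle 1.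
Proof.
refine (@Bundle 1 bool origin_dom (fun P => P == origin)
  (fun c d => (origin_generator d / origin_generator c)%:M) _ _ _ _ _).
- by case; [exact: origin_chart_open | exact: affine_part_open].
- by move=> P; have [->|] := eqVneq P origin.
- move=> c d P cP dP i j; rewrite !ord1 mxE eqxx mulr1n.
  exact: origin_generator_regular.
- by move=> c; rewrite divff ?origin_generator_neq0.
- move=> c d e; rewrite -scalar_mxM mulrC mulrA divfK //.
  exact: origin_generator_neq0.
Defined.

(* E is a non-trivial extension of O(w) by O, hence isomorphic to E_1 *)
Definition is_E1 (E : bundle 2) : Prop :=
  exists (f : bundle_mor trivial_line E) (g : bundle_mor E origin_line),
    short_exact f g /\ ~ splits g.

(* parabolic_line j is a line in the fibre of E at t j, in the coordinates of
   the chart chart_at E (t j) *)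
Record parabolic_structure n (t : 'I_n -> curve_point) (E : bundle 2) :=
Parabolic {
  parabolic_line : 'I_n -> {vspace 'cV[k]_2};
  dim_parabolic_line : forall j, \dim (parabolic_line j) = 1%N
}.

(* the image in the fibre of E at P of the fibre of the line bundle L *)
Definition fibre_image (L : bundle 1) (E : bundle 2) (f : bundle_mor L E)
  (P : curve_point) : {vspace 'cV[k]_2} := <[fibre_mor f P : 'cV[k]_2]>%VS.

Definition passes_through n (t : 'I_n -> curve_point) (E : bundle 2)
    (p : parabolic_structure t E) (L : bundle 1) (f : bundle_mor L E) (j : 'I_n) :=
  (fibre_image f (t j) <= parabolic_line p j)%VS.

(* f : L -> E is the inclusion of a line subbundle *)
Definition line_subbundle (L : bundle 1) (E : bundle 2) (f : bundle_mor L E) :=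
  forall P, fibre_mor f P != 0.

End Curve.

Arguments origin {k C}.

Section Stability.
Variables (R : realType) (C : elliptic_curve R[i]) (n : nat).
Variables (t : 'I_n -> curve_point C) (E : bundle C 2) (p : parabolic_structure t E).

Definition stab (mu : 'I_n -> R) (L : bundle C 1) (f : bundle_mor L E) : R :=
  (degree E)%:~R - 2 * (degree L)%:~R
  + \sum_(j | parabolic_line p j != fibre_image f (t j)) mu j
  - \sum_(j | parabolic_line p j == fibre_image f (t j)) mu j.

Definition semistable (mu : 'I_n -> R) : Prop :=
  forall (L : bundle C 1) (f : bundle_mor L E), line_subbundle f ->
    0 <= stab mu f.

End Stability.

Definition weight_chamber (R : realType) n (I : {set 'I_n}) :
    set ('I_n -> R) :=
  [set mu | (forall j, 0 < mu j < 1) /\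
    \sum_(j in ~: I) mu j - \sum_(j in I) mu j + #|I|%:R < 1].

(* Main.v *)
(* Write J for the set of the j such that p_j is the fibre of a line subbundle L
   of degree d at t_j.  For mu in the chamber of I, Stab_mu(L) differs by less
   than 1 from the odd integer 2 (|I \ J| - k - d) - 1, so L destabilises if and
   only if |I \ J| <= k + d.  If so, the composition of L -> E_1 with
   L(-D) -> L, where D is effective of degree k + d and contains the points t_j
   for j in I \ J, has a source of degree -k and passes through p_j for all j
   in I.  Conversely, if L of degree -k has a nonzero map to E_1 passing through
   p_j for j in I, the line subbundle generated by its image is L(Z), where Z
   is the divisor of zeros of the map; its degree is deg Z - k, and Z contains
   t_j whenever j is in I but p_j is not the fibre of L(Z) at t_j.

   The degree of E_1 is 1 because det E_1 is O(w) up to the divisor of a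
   rational function, and principal divisors have degree 0: for f in k(C) with
   conjugate f' over k(x), the divisors of f and f' have the same degree, and
   f f' lies in k(x), whose nonzero elements are products of constants and of
   powers of functions x - a, for which the claim is checked directly. *)
Require Import Defs.
From HB Require Import structures.
From mathcomp Require Import all_boot all_order all_algebra all_field.
From mathcomp Require Import boolp classical_sets cardinality fsbigop reals.
From mathcomp Require Import complex.
From mathcomp Require Import ring lra zify.

Set Implicit Arguments.
Unset Strict Implicit.
Unset Printing Implicit Defensive.

Import Order.TTheory GRing.Theory Num.Theory.
Local Open Scope classical_set_scope.
Local Open Scope ring_scope.

(** * The function field *)

(** [value_at] and [ord_at] are choices among representations, so nothing can be computed before
    they are shown to be single-valued. For values, a polynomial in the coordinates that is zero in
    the function field must vanish at the point; this comes from the normal form a + b y at affine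
    points and from degree estimates at infinity. For orders, each point needs an explicit z such
    that every nonzero function is a unit times a power of z: x - x_0 if y_0 is nonzero, y at the
    affine points with y_0 = 0, and x / y at the origin. In the first case the order of a + b y is
    read off its norm, which requires 2 to be invertible; in the other two, a and b y have orders of
    different parity and cannot cancel.

    Both modifications of a line bundle, L(Z) and L(-D), are instances of one construction,
    [twist_bundle], with a divisor m of either sign given by local equations. Its degree formula is
    where the vanishing of the degree of principal divisors enters the stability argument. *)

Lemma quadratic_mul (A : comNzRingType) (a b c d y : A) :
  (a + b * y) * (c + d * y) = a * c + b * d * y ^+ 2 + (a * d + b * c) * y.
Proof. ring. Qed.

Lemma quadratic_add (A : comNzRingType) (a b c d y : A) :
  (a + b * y) + (c + d * y) = a + c + (b + d) * y.
Proof. ring. Qed.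

Section FunctionField.
Variables (k : closedFieldType) (C : elliptic_curve k).
Local Notation K := (function_field C).

(* Behind opaque witnesses, failed unifications do not unfold k(x)[y]. *)
Lemma sealed_ratfun : {f : {fraction {poly k}} -> K |
  forall a, f a = to_qfpoly (weierstrass_poly_irreducible C) a%:P}.
Proof.
by exists (fun a => to_qfpoly (weierstrass_poly_irreducible C) a%:P).
Qed.

Definition ratfun : {fraction {poly k}} -> K := sval sealed_ratfun.

Lemma ratfunE a : ratfun a = to_qfpoly (weierstrass_poly_irreducible C) a%:P.
Proof. exact: (svalP sealed_ratfun). Qed.

Lemma ratfun_zmod_morphism : zmod_morphism ratfun.
Proof. by move=> a b; rewrite !ratfunE polyCB; exact: rmorphB. Qed.
HB.instance Definition _ := GRing.isZmodMorphism.Build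
  {fraction {poly k}} K ratfun ratfun_zmod_morphism.

Lemma ratfun_monoid_morphism : monoid_morphism ratfun.
Proof.
split=> [|a b]; rewrite !ratfunE; first exact: rmorph1.
by rewrite polyCM; exact: rmorphM.
Qed.
HB.instance Definition _ := GRing.isMonoidMorphism.Build
  {fraction {poly k}} K ratfun ratfun_monoid_morphism.

Lemma sealed_polyfun :
  {f : {poly k} -> K | forall p, f p = ratfun (tofrac p)}.
Proof. by exists (fun p => ratfun (tofrac p)). Qed.

Definition polyfun : {poly k} -> K := sval sealed_polyfun.

Lemma polyfunE p : polyfun p = ratfun (tofrac p).
Proof. exact: (svalP sealed_polyfun). Qed.

Lemma sealed_ycoord : {y : K | y = yfun C}.
Proof. by exists (yfun C). Qed.

Definition ycoord : K := sval sealed_ycoord.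
Local Notation y := ycoord.

Lemma ycoordE : ycoord = yfun C.
Proof. exact: (svalP sealed_ycoord). Qed.

Lemma polyfun_zmod_morphism : zmod_morphism polyfun.
Proof.
move=> a b; rewrite !polyfunE (rmorphB (@tofrac _)); exact: (rmorphB ratfun).
Qed.
HB.instance Definition _ := GRing.isZmodMorphism.Build
  {poly k} K polyfun polyfun_zmod_morphism.

Lemma polyfun_monoid_morphism : monoid_morphism polyfun.
Proof.
split=> [|a b]; rewrite !polyfunE.
  by rewrite (rmorph1 (@tofrac _)); exact: (rmorph1 ratfun).
by rewrite (rmorphM (@tofrac _)); exact: (rmorphM ratfun).
Qed.
HB.instance Definition _ := GRing.isMonoidMorphism.Build
  {poly k} K polyfun polyfun_monoid_morphism.

Lemma ratfun0 : ratfun 0 = 0. Proof. exact: rmorph0. Qed.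
Lemma ratfun1 : ratfun 1 = 1. Proof. exact: rmorph1. Qed.
Lemma ratfunD a b : ratfun (a + b) = ratfun a + ratfun b.
Proof. exact: rmorphD. Qed.
Lemma ratfunN a : ratfun (- a) = - ratfun a.
Proof. exact: rmorphN. Qed.
Lemma ratfunB a b : ratfun (a - b) = ratfun a - ratfun b.
Proof. exact: rmorphB. Qed.
Lemma ratfunM a b : ratfun (a * b) = ratfun a * ratfun b.
Proof. exact: rmorphM. Qed.

Lemma polyfun0 : polyfun 0 = 0. Proof. exact: rmorph0. Qed.
Lemma polyfun1 : polyfun 1 = 1. Proof. exact: rmorph1. Qed.
Lemma polyfunD p q : polyfun (p + q) = polyfun p + polyfun q.
Proof. exact: rmorphD. Qed.
Lemma polyfunB p q : polyfun (p - q) = polyfun p - polyfun q.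
Proof. exact: rmorphB. Qed.
Lemma polyfunM p q : polyfun (p * q) = polyfun p * polyfun q.
Proof. exact: rmorphM. Qed.
Lemma polyfunX p n : polyfun (p ^+ n) = polyfun p ^+ n.
Proof. exact: rmorphXn. Qed.

Lemma constantE c : Defs.constant C c = polyfun c%:P.
Proof. by rewrite polyfunE ratfunE. Qed.
Lemma xfunE : xfun C = polyfun 'X.
Proof. by rewrite polyfunE ratfunE. Qed.

Lemma polyfun_eq0 p : (polyfun p == 0) = (p == 0).
Proof. by rewrite polyfunE (fmorph_eq0 ratfun) tofrac_eq0. Qed.


Lemma yfun_sqr : y ^+ 2 = polyfun (cubic C).
Proof.
apply/eqP; rewrite -subr_eq0 ycoordE polyfunE ratfunE /yfun -rmorphXn -rmorphB.
apply/eqP/val_inj => /=.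
rewrite [mk_monic _]mk_monicE; last exact: weierstrass_poly_irreducible.
by apply: Pdiv.CommonRing.rmodpp; exact: mulrC.
Qed.

(** A polynomial of degree at most 1 is its own remainder modulo the Weierstrass polynomial. Hence 1
    and [ycoord] form a basis of the function field over k(x). *)
Lemma val_ratfun_pair a b :
  polyn (ratfun a + ratfun b * ycoord : K) = a%:P + b%:P * 'X.
Proof.
have -> : ratfun a + ratfun b * y =
    to_qfpoly (weierstrass_poly_irreducible C) (a%:P + b%:P * 'X).
  by rewrite !ratfunE ycoordE rmorphD rmorphM.
apply: in_qpoly_small; rewrite mk_monicE;
  last exact: weierstrass_poly_irreducible.
rewrite size_weierstrass_poly (leq_ltn_trans (size_polyD _ _)) //.
rewrite gtn_max size_polyC mul_polyC.
rewrite (leq_ltn_trans (size_scale_leq _ _)) ?size_polyX //.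
by case: eqP.
Qed.

Lemma ratfun_repr (f : K) : exists a b, f = ratfun a + ratfun b * y.
Proof.
have sz (p : K) : (size (polyn p) <= 2)%N.
  apply: leq_trans (size_npoly p) _; rewrite mk_monicE.
    by rewrite size_weierstrass_poly.
  exact: weierstrass_poly_irreducible.
exists (polyn f)`_0, (polyn f)`_1; apply: val_inj.
rewrite [RHS]val_ratfun_pair; apply/polyP => i.
rewrite coefD coefC coefCM coefX; case: i => [|[|i]] /=.
- by rewrite mulr0 addr0.
- by rewrite mulr1 add0r.
- by rewrite mulr0 addr0 nth_default // (leq_trans (sz f)).
Qed.

Lemma ratfun_eq0 a b : ratfun a + ratfun b * y = 0 -> a = 0 /\ b = 0.
Proof.
move=> /(congr1 (fun f : K => polyn f)); rewrite val_ratfun_pair.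
change (polyn (0 : K)) with (0 : {poly {fraction {poly k}}}) => e.
have e0 : (a%:P + b%:P * 'X)`_0 = 0 by rewrite e coef0.
have e1 : (a%:P + b%:P * 'X)`_1 = 0 by rewrite e coef0.
move: e0 e1; rewrite !coefD !coefCM !coefC !coefX !eqxx mulr0 addr0 mulr1.
by rewrite add0r.
Qed.

Lemma ratfun_inj a b a' b' :
  ratfun a + ratfun b * y = ratfun a' + ratfun b' * y -> a = a' /\ b = b'.
Proof.
move=> e; have [] := @ratfun_eq0 (a - a') (b - b').
  by rewrite !rmorphB mulrBl addrACA e -opprD subrr.
by clear e => /subr0_eq ea /subr0_eq eb; split; [exact: ea | exact: eb].
Qed.


Lemma polyfun_repr (f : K) : exists a b d,
  d != 0 /\ f * polyfun d = polyfun a + polyfun b * y.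
Proof.
have [a [b ->]] := ratfun_repr f.
have [na [da [da0 ea]]] := fraction_repr a.
have {}ea : ratfun a * polyfun da = polyfun na.
  by rewrite !polyfunE -ea ratfunM.
have [nb [db [db0 eb]]] := fraction_repr b.
have {}eb : ratfun b * polyfun db = polyfun nb.
  by rewrite !polyfunE -eb ratfunM.
exists (na * db), (nb * da), (da * db); split; first by rewrite mulf_neq0.
rewrite !polyfunM -ea -eb.
have id (A : comNzRingType) (a' b' p q t : A) :
    (a' + b' * t) * (p * q) = a' * p * q + b' * q * p * t by ring.
exact: id.
Qed.

Lemma polyfun_pair_eq0 a b : polyfun a + polyfun b * y = 0 -> a = 0 /\ b = 0.
Proof.
rewrite !polyfunE => /ratfun_eq0[/eqP + /eqP].
by rewrite !tofrac_eq0 => /eqP -> /eqP.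
Qed.

Lemma conjugate_exists (f : K) : exists g : K, exists a b,
  f = ratfun a + ratfun b * y /\ g = ratfun a - ratfun b * y.
Proof.
by have [a [b e]] := ratfun_repr f; exists (ratfun a - ratfun b * y), a, b.
Qed.

(** The nontrivial automorphism of the function field over k(x), sending y to - y. The choice made
    by [cid] is harmless because the coordinates of f are unique, by [ratfun_inj]. *)
Definition conjugate (f : K) : K := projT1 (cid (conjugate_exists f)).

Lemma conjugateE f a b : f = ratfun a + ratfun b * y ->
  conjugate f = ratfun a - ratfun b * y.
Proof.
rewrite /conjugate; case: cid => /= g [a' [b' [-> ->]]] e.
by have [-> ->] := ratfun_inj e.
Qed.

Lemma conjugate_zmod_morphism : zmod_morphism conjugate.
Proof.
move=> f g; have [a [b ef]] := ratfun_repr f; have [c [d eg]] := ratfun_repr g.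
have efg : f - g = ratfun (a - c) + ratfun (b - d) * y.
  by rewrite ef eg !ratfunB mulrBl addrACA -opprD.
rewrite (conjugateE efg) (conjugateE ef) (conjugateE eg) !ratfunB.
have id (A : comNzRingType) (a' b' c' d' t : A) :
    a' - c' - (b' - d') * t = a' - b' * t - (c' - d' * t) by ring.
exact: id.
Qed.

Lemma conjugate_monoid_morphism : monoid_morphism conjugate.
Proof.
split=> [|f g].
  have e1 : 1 = ratfun 1 + ratfun 0 * y.
    by rewrite ratfun0 ratfun1 mul0r addr0.
  by rewrite (conjugateE e1) ratfun0 ratfun1 mul0r subr0.
have [a [b ef]] := ratfun_repr f; have [c [d eg]] := ratfun_repr g.
have y2 : y ^+ 2 = ratfun (tofrac (cubic C)) by rewrite yfun_sqr polyfunE.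
set e := tofrac (cubic C) in y2.
have efg : f * g = ratfun (a * c + b * d * e) + ratfun (a * d + b * c) * y.
  by rewrite ef eg !(ratfunD, ratfunM) -y2; exact: quadratic_mul.
rewrite (conjugateE efg) (conjugateE ef) (conjugateE eg) !(ratfunD,
  ratfunM) -y2.
have id (A : comNzRingType) (a' b' c' d' t : A) :
    a' * c' + b' * d' * t ^+ 2 - (a' * d' + b' * c') * t =
    (a' - b' * t) * (c' - d' * t) by ring.
exact: id.
Qed.

HB.instance Definition _ := GRing.isZmodMorphism.Build K K conjugate
  conjugate_zmod_morphism.
HB.instance Definition _ := GRing.isMonoidMorphism.Build K K conjugate
  conjugate_monoid_morphism.

Lemma conjugateD f g : conjugate (f + g) = conjugate f + conjugate g.
Proof. exact: rmorphD. Qed.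

Lemma conjugateM f g : conjugate (f * g) = conjugate f * conjugate g.
Proof. exact: rmorphM. Qed.

Lemma conjugateV f : conjugate f^-1 = (conjugate f)^-1.
Proof. exact: fmorphV. Qed.

Lemma conjugateXz f (n : int) : conjugate (f ^ n) = conjugate f ^ n.
Proof.
have conjX m : conjugate (f ^+ m) = conjugate f ^+ m by exact: rmorphXn.
case: n => n; first exact: conjX.
by rewrite -[f ^ _]/((f ^+ n.+1)^-1) conjugateV conjX.
Qed.

Lemma conjugate_polyfun p : conjugate (polyfun p) = polyfun p.
Proof.
have e : polyfun p = ratfun (tofrac p) + ratfun 0 * y.
  by rewrite ratfun0 mul0r addr0 polyfunE.
by rewrite polyfunE in e *; rewrite (conjugateE e) ratfun0 mul0r subr0.
Qed.

Lemma conjugate_yfun : conjugate y = - y.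
Proof.
have e : y = ratfun 0 + ratfun 1 * y by rewrite ratfun0 ratfun1 mul1r add0r.
by rewrite (conjugateE e) ratfun0 ratfun1 mul1r add0r.
Qed.

Lemma conjugateK : involutive conjugate.
Proof.
move=> f; have [a [b ef]] := ratfun_repr f.
have ef' : conjugate f = ratfun a + ratfun (- b) * y.
  by rewrite (conjugateE ef) ratfunN mulNr.
by rewrite (conjugateE ef') ratfunN mulNr opprK -ef.
Qed.

(** The norm from the function field to k(x): it reduces questions about a + b y to a polynomial in
    x. *)
Lemma polyfun_norm a b :
  (polyfun a + polyfun b * y) * (polyfun a - polyfun b * y) =
  polyfun (a ^+ 2 - cubic C * b ^+ 2).
Proof.
rewrite polyfunB polyfunM !polyfunX -yfun_sqr.
have id (A : comNzRingType) (a' b' t : A) :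
    (a' + b' * t) * (a' - b' * t) = a' ^+ 2 - t ^+ 2 * b' ^+ 2 by ring.
exact: id.
Qed.

End FunctionField.

(** * Values of regular functions *)

Section BivariateEvaluation.
Variables (A B : comNzRingType) (h : {rmorphism A -> B}) (u v : B).

Definition eval2_morphism : {rmorphism {poly {poly A}} -> B} :=
  horner_eval v \o map_poly (horner_eval u \o map_poly h).

Lemma eval2E p : eval2 h p u v = eval2_morphism p. Proof. by []. Qed.

Lemma eval2D p q : eval2 h (p + q) u v = eval2 h p u v + eval2 h q u v.
Proof. by rewrite !eval2E; exact: rmorphD. Qed.

Lemma eval2M p q : eval2 h (p * q) u v = eval2 h p u v * eval2 h q u v.
Proof. by rewrite !eval2E; exact: rmorphM. Qed.

Lemma eval2_constant c : eval2 h c%:P%:P u v = h c.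
Proof.
by rewrite /eval2 map_polyC hornerC /= map_polyC /horner_eval hornerC.
Qed.

Lemma eval2_inner : eval2 h 'X%:P u v = u.
Proof.
by rewrite /eval2 map_polyC hornerC /= map_polyX /horner_eval hornerX.
Qed.

Lemma eval2_outer : eval2 h 'X u v = v.
Proof. by rewrite /eval2 map_polyX hornerX. Qed.
End BivariateEvaluation.

(** Constants and the two variables generate the polynomial ring, so statements about evaluation
    need only be checked on these generators. *)
Lemma bivariate_ind (A : nzRingType) (Q : {poly {poly A}} -> Prop) :
  (forall c, Q c%:P%:P) -> Q 'X%:P -> Q 'X ->
  (forall p q, Q p -> Q q -> Q (p + q)) ->
  (forall p q, Q p -> Q q -> Q (p * q)) -> forall p, Q p.
Proof.
move=> QC QX QY QD QM; elim/poly_ind => [|p c IHp]; first exact: (QC 0).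
apply: (QD _ _ _ _); first exact: (QM _ _ _ _).
elim/poly_ind: c => [|c a IHc]; first exact: (QC 0).
by rewrite polyCD polyCM; apply: (QD _ _ _ _);
  [exact: (QM _ _ _ _) | exact: QC].
Qed.

Lemma rmorph_eval2 (A B : comNzRingType) (h : {rmorphism A -> B})
    (g : {rmorphism B -> B}) p u v :
  (forall c, g (h c) = h c) -> g (eval2 h p u v) = eval2 h p (g u) (g v).
Proof.
move=> gh; elim/bivariate_ind: p => [c||||].
- by rewrite !eval2_constant.
- by rewrite !eval2_inner.
- by rewrite !eval2_outer.
- by move=> p q IHp IHq; rewrite !eval2D rmorphD IHp IHq.
- by move=> p q IHp IHq; rewrite !eval2M rmorphM IHp IHq.
Qed.

Section LocalRings.
Variables (k : closedFieldType) (C : elliptic_curve k).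
Local Notation K := (function_field C).
Local Notation y := (ycoord C).
Local Notation polyfun := (@polyfun k C).
Local Notation O := (@origin k C).
Local Notation const c := (polyfun c%:P).


Lemma sealed_local_fun :
  {f : curve_point C -> {poly {poly k}} ->
    K | forall P p, f P p = poly_fun P p}.
Proof. by exists (@poly_fun k C). Qed.

Definition local_fun : curve_point C -> {poly {poly k}} -> K :=
  sval sealed_local_fun.

Lemma local_funE P p : local_fun P p = poly_fun P p.
Proof. exact: (svalP sealed_local_fun). Qed.

Lemma local_funD P p q : local_fun P (p + q) = local_fun P p + local_fun P q.
Proof. by rewrite !local_funE; exact: eval2D. Qed.

Lemma local_funB P p q : local_fun P (p - q) = local_fun P p - local_fun P q.
Proof. by rewrite !local_funE /poly_fun !eval2E; exact: rmorphB. Qed.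

Lemma local_funM P p q : local_fun P (p * q) = local_fun P p * local_fun P q.
Proof. by rewrite !local_funE; exact: eval2M. Qed.

Lemma local_funC P c : local_fun P c%:P%:P = const c.
Proof. by rewrite local_funE /poly_fun eval2_constant constantE. Qed.

Lemma poly_valD (P : curve_point C) p q :
  poly_val P (p + q) = poly_val P p + poly_val P q.
Proof. exact: eval2D. Qed.

Lemma poly_valB (P : curve_point C) p q :
  poly_val P (p - q) = poly_val P p - poly_val P q.
Proof. by rewrite /poly_val !eval2E; exact: rmorphB. Qed.

Lemma poly_valM (P : curve_point C) p q :
  poly_val P (p * q) = poly_val P p * poly_val P q.
Proof. exact: eval2M. Qed.

Lemma poly_valC (P : curve_point C) c : poly_val P c%:P%:P = c.
Proof. exact: eval2_constant. Qed.

Lemma constant0 : const 0 = 0. Proof. exact: polyfun0. Qed.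
Lemma constant1 : const 1 = 1. Proof. exact: polyfun1. Qed.
Lemma constantD c d : const (c + d) = const c + const d.
Proof. by rewrite polyCD polyfunD. Qed.
Lemma constantN c : const (- c) = - const c.
Proof. by rewrite polyCN; exact: rmorphN. Qed.
Lemma constantM c d : const (c * d) = const c * const d.
Proof. by rewrite polyCM polyfunM. Qed.

(** Function and value are followed together, through any relation compatible with the ring
    operations. A suitable [rel] then forces the value to be 0 when the function is 0. *)
Lemma local_fun_val_rel (P : curve_point C) (rel : K -> k -> Prop) :
  (forall c, rel (const c) c) ->
  rel (coord_fun P).1 (coord_val P).1 -> rel (coord_fun P).2 (coord_val P).2 ->
  (forall f c g d, rel f c -> rel g d -> rel (f + g) (c + d)) ->
  (forall f c g d, rel f c -> rel g d -> rel (f * g) (c * d)) ->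
  forall p, rel (local_fun P p) (poly_val P p).
Proof.
move=> relC relX relY relD relM; elim/bivariate_ind.
- by move=> c; rewrite local_funC poly_valC.
- by rewrite local_funE poly_funX poly_valX.
- by rewrite local_funE poly_funY poly_valY.
- by move=> p q; rewrite local_funD poly_valD; exact: relD.
- by move=> p q; rewrite local_funM poly_valM; exact: relM.
Qed.

Lemma on_curve_eq u v (Cuv : on_curve C (Some (u, v))) :
  v ^+ 2 = (cubic C).[u].
Proof. exact/eqP. Qed.

Lemma poly_val_affine_eq0 (P : curve_point C) p : P != origin ->
  local_fun P p = 0 -> poly_val P p = 0.
Proof.
case: P => -[[x0 y0]|] CP // _; set P := exist _ _ _.
(* The relation records a normal form a + b y together with its value; if the function is 0,
   uniqueness of the normal form gives a = b = 0. *)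
pose rel (f : K) c := exists a b,
  f = polyfun a + polyfun b * y /\ c = a.[x0] + b.[x0] * y0.
suff relP : forall p, rel (local_fun P p) (poly_val P p).
  have [a [b [-> ->]]] := relP p.
  by case/polyfun_pair_eq0 => -> ->; rewrite !horner0 mul0r addr0.
apply: local_fun_val_rel.
- move=> c; exists c%:P, 0.
  by rewrite hornerC horner0 polyfun0 !mul0r !addr0.
- exists 'X, 0; rewrite hornerX horner0 polyfun0 !mul0r !addr0.
  by rewrite /= xfunE.
- exists 0, 1; rewrite horner0 -[1.[x0]]/((1%:P).[x0]) hornerC.
  by rewrite polyfun0 polyfun1 !mul1r !add0r ycoordE.
- move=> f c g d [a [b [-> ->]]] [a' [b' [-> ->]]].
  exists (a + a'), (b + b').
  by rewrite !polyfunD !hornerD; split; exact: quadratic_add.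
- move=> f c g d [a [b [-> ->]]] [a' [b' [-> ->]]].
  exists (a * a' + b * b' * cubic C), (a * b' + b * a').
  rewrite !polyfunD !polyfunM !hornerD !hornerM -yfun_sqr -(on_curve_eq CP).
  by split; exact: quadratic_mul.
Qed.

Lemma size_polyMD_leq (p q r s : {poly k}) m :
  (size p + size q <= m.+1)%N -> (size r + size s <= m.+1)%N ->
  (size (p * q + r * s)%R <= m)%N.
Proof.
move=> pq rs; apply: leq_trans (size_polyD _ _) _; rewrite geq_max.
rewrite !(leq_trans (size_polyMleq _ _)) //; first by case: (_ + _)%N rs.
by case: (_ + _)%N pq.
Qed.

(* As x and y have poles of order 2 and 3 at infinity, (a + b y) / d vanishes
   there if deg a < deg d and deg b + 2 <= deg d. *)
Definition small_at_origin (f : K) := exists a b d : {poly k},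
  [/\ (2 < size d)%N, (size a < size d)%N, (size b <= size d - 2)%N &
      f * polyfun d = polyfun a + polyfun b * y].

Lemma small_at_originD f g :
  small_at_origin f -> small_at_origin g -> small_at_origin (f + g).
Proof.
move=> [a [b [d [d2 ad bd e]]]] [a' [b' [d' [d2' ad' bd' e']]]].
exists (a * d' + a' * d), (b * d' + b' * d), (d * d').
have sd : size (d * d') = (size d + size d').-1.
  by rewrite size_mul // -size_poly_gt0 (leq_trans _ d2, leq_trans _ d2').
split.
- by rewrite sd; lia.
- by rewrite sd; apply: (@leq_ltn_trans (size d + size d').-2);
    [apply: size_polyMD_leq|]; lia.
- by rewrite sd; apply: size_polyMD_leq; lia.
- rewrite !polyfunD !polyfunM.
  have -> : (f + g) * (polyfun d * polyfun d') =
      (f * polyfun d) * polyfun d' + (g * polyfun d') * polyfun d.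
    have id (A : comNzRingType) (f' g' p q : A) :
      (f' + g') * (p * q) = f' * p * q + g' * q * p by ring.
    exact: id.
  rewrite e e'.
  have id (A : comNzRingType) (p q p' q' r s t : A) :
    (p + q * t) * r + (p' + q' * t) * s = p * r + p' * s + (q * r + q' * s) * t.
    by ring.
  exact: id.
Qed.

Lemma small_at_originM f g :
  small_at_origin f -> small_at_origin g -> small_at_origin (f * g).
Proof.
move=> [a [b [d [d2 ad bd e]]]] [a' [b' [d' [d2' ad' bd' e']]]].
exists (a * a' + b * b' * cubic C), (a * b' + b * a'), (d * d').
have sd : size (d * d') = (size d + size d').-1.
  by rewrite size_mul // -size_poly_gt0 (leq_trans _ d2, leq_trans _ d2').
split.
- by rewrite sd; lia.
(* The estimate is tight: the margins of 2 for b and b' are just enough to absorb the factor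
   [cubic], of size 4, that replaces y^2. *)
- have bb' : (size (b * b')%R <= (size b + size b').-1)%N := size_polyMleq b b'.
  rewrite sd; apply: (@leq_ltn_trans (size d + size d').-2); last by lia.
  by apply: size_polyMD_leq; rewrite ?size_cubic; lia.
- by rewrite sd; apply: size_polyMD_leq; lia.
- rewrite !polyfunD !polyfunM mulrACA e e' -yfun_sqr quadratic_mul.
  by congr (_ + _ * _).
Qed.

Lemma small_at_originZ c f : small_at_origin f -> small_at_origin (const c * f).
Proof.
move=> [a [b [d [d2 ad bd e]]]]; exists (c *: a), (c *: b), d; split.
- exact: d2.
- by rewrite (leq_ltn_trans (size_scale_leq _ _)).
- by rewrite (leq_trans (size_scale_leq _ _)).
- by rewrite -!mul_polyC !polyfunM -mulrA e mulrDr mulrA.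
Qed.

(** Uniqueness of coordinates gives a = c d, which for nonzero c has the same degree as d. *)
Lemma small_at_origin_constant c : small_at_origin (const c) -> c = 0.
Proof.
move=> [a [b [d [d2 ad bd]]]]; rewrite -polyfunM => e.
have [] := @polyfun_pair_eq0 _ C (a - c%:P * d) b.
  by rewrite polyfunB addrAC -e subrr.
move=> /subr0_eq acd _; apply: contraTeq ad => c0.
by rewrite acd mul_polyC size_scale // ltnn.
Qed.

Lemma ycoord_neq0 : y != 0.
Proof. by rewrite ycoordE yfun_neq0. Qed.

Lemma inv_yfun : y^-1 = y / polyfun (cubic C).
Proof.
by rewrite -yfun_sqr expr2 invfM mulrA divff ?ycoord_neq0 ?mul1r.
Qed.

Lemma polyfun_cubic_neq0 : polyfun (cubic C) != 0.
Proof. by rewrite -yfun_sqr expf_neq0 ?ycoord_neq0. Qed.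

Lemma poly_val_origin_eq0 p :
  local_fun O p = 0 -> poly_val O p = 0.
Proof.
(* The functions [small_at_origin] stand in for the maximal ideal at infinity: the relation says
   that f is congruent to c. *)
pose rel (f : K) c := small_at_origin (f - const c).
suff relP : rel (local_fun O p) (poly_val O p).
  move=> e; move: relP; rewrite /rel e sub0r => /(small_at_originZ (-1)).
  have -> : const (- 1) * - const (poly_val O p) = const (poly_val O p).
    by rewrite constantN constant1 mulN1r opprK.
  exact: small_at_origin_constant.
apply: local_fun_val_rel => {p}.
(* For the function 0 any denominator of size at least 3 will do. *)
- move=> c; rewrite /rel subrr; exists 0, 0, 'X^2.
  by rewrite size_polyXn size_poly0 !polyfun0 !mul0r addr0.
(* Since y^2 is the cubic, x / y = x y / [cubic] and 1 / y = y / [cubic]; these are the witnesses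
   here and in the next case. *)
- exists 0, 'X, (cubic C); rewrite size_cubic size_poly0 size_polyX; split;
    [by [] | by [] | by [] |].
  rewrite /coord_fun /coord_val /= polyC0 !polyfun0 subr0 add0r -ycoordE ?xfunE
    inv_yfun mulrA divfK //.
  exact: polyfun_cubic_neq0.
- exists 0, 1, (cubic C); rewrite size_cubic size_poly0 size_poly1; split;
    [by [] | by [] | by [] |].
  rewrite /coord_fun /coord_val /= polyC0 !polyfun0 subr0 add0r -ycoordE ?xfunE
    inv_yfun polyfun1 mul1r divfK //.
  exact: polyfun_cubic_neq0.
- move=> f c g d fc gd; rewrite /rel constantD opprD addrACA.
  exact: small_at_originD.
- move=> f c g d fc gd; rewrite /rel constantM.
  have -> : f * g - const c * const d = (f - const c) * (g - const d) +
      (const c * (g - const d) + const d * (f - const c)).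
    have id (A : comNzRingType) (p q r s : A) :
        p * q - r * s = (p - r) * (q - s) + (r * (q - s) + s * (p - r)) by ring.
    exact: id.
  apply: small_at_originD; first exact: small_at_originM.
  by apply: small_at_originD; exact: small_at_originZ.
Qed.

Lemma poly_val_eq0 (P : curve_point C) p :
  local_fun P p = 0 -> poly_val P p = 0.
Proof.
have [->|] := eqVneq P origin; first exact: poly_val_origin_eq0.
exact: poly_val_affine_eq0.
Qed.

Definition has_value (P : curve_point C) (f : K) (c : k) := exists p q,
  [/\ poly_val P q != 0, f = local_fun P p / local_fun P q &
      c = poly_val P p / poly_val P q].

Lemma local_fun_neq0 (P : curve_point C) q : poly_val P q != 0 ->
  local_fun P q != 0.
Proof. by apply: contra_neq; exact: poly_val_eq0. Qed.

(** Cross-multiplying two fractions for f gives a polynomial that is zero in the function field,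
    hence zero at P by [poly_val_eq0]. This makes [value_at] computable. *)
Lemma has_value_unique P f c d : has_value P f c -> has_value P f d -> c = d.
Proof.
move=> [p [q [q0 -> ->]]] [p' [q' [q0' + ->]]] => /eqP.
rewrite eqr_div ?local_fun_neq0 // => /eqP e.
have e0 : local_fun P (p * q' - p' * q) = 0.
  by rewrite local_funB (local_funM P p) (local_funM P p') e subrr.
apply/eqP; rewrite eqr_div // -subr_eq0 -!poly_valM.
by rewrite -poly_valB (poly_val_eq0 e0).
Qed.

Lemma has_value_at P f c : has_value P f c -> value_at P f = c.
Proof.
move=> fc; apply: xget_unique => [|d [p [q [q0 e ed]]]].
  by have [p [q [q0 e ec]]] := fc; exists p, q; rewrite -!local_funE.
by apply: has_value_unique fc; exists p, q; rewrite !local_funE.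
Qed.

Lemma regular_atP P f : regular_at P f <-> has_value P f (value_at P f).
Proof.
split=> [[p [q [q0 e]]]|[p [q [q0 e _]]]]; last first.
  by exists p, q; rewrite -!local_funE.
rewrite -!local_funE in e.
have fc : has_value P f (poly_val P p / poly_val P q) by exists p, q.
by rewrite (has_value_at fc).
Qed.

Lemma has_value_regular P f c : has_value P f c -> regular_at P f.
Proof. by move=> [p [q [q0 e _]]]; exists p, q; rewrite -!local_funE. Qed.

Lemma has_value_constant P c : has_value P (const c) c.
Proof.
exists c%:P%:P, 1%:P%:P; rewrite !poly_valC !local_funC oner_neq0.
by rewrite constant1 !divr1.
Qed.

Lemma has_valueD P f c g d :
  has_value P f c -> has_value P g d -> has_value P (f + g) (c + d).
Proof.
move=> [p [q [q0 -> ->]]] [p' [q' [q0' -> ->]]].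
exists (p * q' + p' * q), (q * q'); rewrite !(poly_valM,
  poly_valD) mulf_neq0 //.
by rewrite !(local_funM, local_funD) -!addf_div // local_fun_neq0.
Qed.

Lemma has_valueM P f c g d :
  has_value P f c -> has_value P g d -> has_value P (f * g) (c * d).
Proof.
move=> [p [q [q0 -> ->]]] [p' [q' [q0' -> ->]]].
exists (p * p'), (q * q'); rewrite !poly_valM mulf_neq0 //.
by rewrite !local_funM !mulf_div.
Qed.

Lemma has_valueV P f c : has_value P f c -> c != 0 -> has_value P f^-1 c^-1.
Proof.
move=> [p [q [q0 -> ->]]]; rewrite mulf_eq0 negb_or => /andP[p0 _].
by exists q, p; rewrite !invf_div.
Qed.

Lemma has_value_eval2 Q u a v b p : has_value Q u a -> has_value Q v b ->
  has_value Q (eval2 (Defs.constant C) p u v) (eval2 idfun p a b).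
Proof.
move=> ua vb; elim/bivariate_ind: p => [c||||].
- by rewrite !eval2_constant constantE; exact: has_value_constant.
- by rewrite !eval2_inner.
- by rewrite !eval2_outer.
- by move=> p q IHp IHq; rewrite !eval2D; exact: has_valueD.
- by move=> p q IHp IHq; rewrite !eval2M; exact: has_valueM.
Qed.

Lemma has_value_coord (P : curve_point C) :
  has_value P (coord_fun P).1 (coord_val P).1 /\
  has_value P (coord_fun P).2 (coord_val P).2.
Proof.
split; [exists 'X%:P, 1%:P%:P | exists 'X, 1%:P%:P];
  rewrite !poly_valC !local_funC;
  rewrite constant1 !divr1 oner_neq0.
  by rewrite poly_valX local_funE poly_funX.
by rewrite poly_valY local_funE poly_funY.
Qed.

Lemma regular_constant P c : regular_at P (const c).
Proof. exact: has_value_regular (has_value_constant P c). Qed.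

Lemma value_constant P c : value_at P (const c) = c.
Proof. exact: has_value_at (has_value_constant P c). Qed.

Lemma regular0 (P : curve_point C) : regular_at P 0.
Proof. by rewrite -constant0; exact: regular_constant. Qed.

Lemma value0 (P : curve_point C) : value_at P 0 = 0.
Proof. by rewrite -constant0; exact: value_constant. Qed.

Lemma value1 (P : curve_point C) : value_at P 1 = 1.
Proof. by rewrite -constant1; exact: value_constant. Qed.

Section Operations.
Variable P : curve_point C.
Implicit Types f g : K.

Lemma regularD f g : regular_at P f -> regular_at P g -> regular_at P (f + g).
Proof.
by move=> /regular_atP fP /regular_atP gP;
  apply: has_value_regular (has_valueD fP gP).
Qed.

Lemma valueD f g : regular_at P f -> regular_at P g ->
  value_at P (f + g) = value_at P f + value_at P g.
Proof.
by move=> /regular_atP fP /regular_atP gP;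
  exact: has_value_at (has_valueD fP gP).
Qed.

Lemma regularM f g : regular_at P f -> regular_at P g -> regular_at P (f * g).
Proof.
by move=> /regular_atP fP /regular_atP gP;
  apply: has_value_regular (has_valueM fP gP).
Qed.

Lemma valueM f g : regular_at P f -> regular_at P g ->
  value_at P (f * g) = value_at P f * value_at P g.
Proof.
by move=> /regular_atP fP /regular_atP gP;
  exact: has_value_at (has_valueM fP gP).
Qed.

Lemma regularN f : regular_at P f -> regular_at P (- f).
Proof.
move=> fP; have -> : - f = const (- 1) * f.
  by rewrite constantN constant1 mulN1r.
by apply: regularM fP; exact: regular_constant.
Qed.

Lemma regularX f n : regular_at P f -> regular_at P (f ^+ n).
Proof.
move=> fP; elim: n => [|n IHn]; first exact: regular_at1.
by rewrite exprS; exact: regularM.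
Qed.

Definition local_unit f := regular_at P f /\ value_at P f != 0.

Lemma local_unit_neq0 f : local_unit f -> f != 0.
Proof. by move=> [_]; apply: contra_neq => ->; exact: value0. Qed.

Lemma local_unit1 : local_unit 1.
Proof. by split; [exact: regular_at1 | rewrite value1 oner_neq0]. Qed.

Lemma local_unit_constant c : c != 0 -> local_unit (const c).
Proof.
by move=> c0; split; [exact: regular_constant | rewrite value_constant].
Qed.

Lemma local_unitM f g : local_unit f -> local_unit g -> local_unit (f * g).
Proof.
by move=> [fP f0] [gP g0]; split; [exact: regularM | rewrite valueM //
  mulf_neq0].
Qed.

Lemma local_unitV f : local_unit f -> local_unit f^-1.
Proof.
move=> [/regular_atP fP f0]; have fV := has_valueV fP f0.
by split; [exact: has_value_regular fV | rewrite (has_value_at fV) invr_neq0].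
Qed.

Lemma local_unitX f n : local_unit f -> local_unit (f ^+ n).
Proof.
move=> fP; elim: n => [|n IHn]; first exact: local_unit1.
by rewrite exprS; exact: local_unitM.
Qed.
End Operations.

End LocalRings.

(** * Uniformizers *)

(* The Weierstrass equation in the coordinates s = X / Y, w = 1 / Y:
   w (1 - a s w - b w^2) = s^3. *)
Lemma weierstrass_at_origin (F : fieldType) (a b X Y : F) :
  Y != 0 -> Y ^+ 2 = X ^+ 3 + a * X + b ->
  (X / Y) ^+ 3 = Y^-1 * (1 + - a * (X / Y * Y^-1) + - b * (Y^-1 * Y^-1)).
Proof.
move=> Y0 e; have X3 : X ^+ 3 = Y ^+ 2 - a * X - b by rewrite e; ring.
by rewrite exprMn X3; field.
Qed.

Section Uniformizers.
Variables (k : closedFieldType) (C : elliptic_curve k).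
Hypothesis two_neq0 : (2 : k) != 0.
Local Notation K := (function_field C).
Local Notation y := (ycoord C).
Local Notation polyfun := (@polyfun k C).
Local Notation O := (@origin k C).
Local Notation const c := (polyfun c%:P).

Section Factorization.
Variables (P : curve_point C) (z : K).
Hypotheses (z0 : z != 0) (zP : regular_at P z) (zv : value_at P z = 0).
Implicit Types (f g : K) (n m : int).

Definition has_order f n := exists2 u, local_unit P u & f = u * z ^ n.

Lemma has_order_unit u : local_unit P u -> has_order u 0.
Proof. by exists u => //; rewrite expr0z mulr1. Qed.

Lemma has_orderM f g n m :
  has_order f n -> has_order g m -> has_order (f * g) (n + m).
Proof.
move=> [u uP ->] [v vP ->]; exists (u * v); first exact: local_unitM.
by rewrite expfzDr // mulrACA.
Qed.

Lemma has_orderV f n : has_order f n -> has_order f^-1 (- n).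
Proof.
move=> [u uP ->]; exists u^-1; first exact: local_unitV.
by rewrite invfM -invr_expz.
Qed.

Lemma has_order_uniformizer : has_order z 1.
Proof. by exists 1; [exact: local_unit1 | rewrite mul1r expr1z]. Qed.

Lemma has_order_prod (I : Type) (s : seq I) (F : I -> K) (Q : int -> Prop) :
  Q 0 -> (forall n m, Q n -> Q m -> Q (n + m)) ->
  (forall i, exists2 n, Q n & has_order (F i) n) ->
  exists2 n, Q n & has_order (\prod_(i <- s) F i) n.
Proof.
move=> Q0 QD FQ; elim: s => [|i s [n Qn IHs]].
  by rewrite big_nil; exists 0 => //; exact: has_order_unit (local_unit1 P).
rewrite big_cons; have [m Qm Fm] := FQ i.
by exists (m + n); [exact: QD | exact: has_orderM].
Qed.

(** Over a closed field p is a product of linear factors. The predicate [Q] lets one induction yield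
    either the mere existence of an order or, at branch points, its evenness. *)
Lemma has_order_polyfun (Q : int -> Prop) p : p != 0 ->
  Q 0 -> (forall n m, Q n -> Q m -> Q (n + m)) ->
  (forall a, exists2 n, Q n & has_order (polyfun ('X - a%:P)) n) ->
  exists2 n, Q n & has_order (polyfun p) n.
Proof.
move=> p0 Q0 QD QX; have [s ->] := closed_field_poly_normal p.
rewrite -mul_polyC polyfunM.
have [|n Qn sn] := @has_order_prod _ s (fun a => polyfun ('X - a%:P)) Q Q0 QD.
  exact: QX.
exists n => //; rewrite -[n]add0r; apply: has_orderM.
  by apply/has_order_unit/local_unit_constant; rewrite lead_coef_eq0.
by rewrite (big_morph polyfun (@polyfunM k C) (@polyfun1 k C)).
Qed.

Lemma has_order_lt f g n m :
  has_order f n -> has_order g m -> n < m -> has_order (f + g) n.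
Proof.
move=> [u [uP u0] ->] [v [vP v0] ->] nm.
have [j ->] : exists j : nat, m = n + j.+1%:Z.
  by exists `|m - n|%N.-1; lia.
exists (u + v * z ^+ j.+1).
  have rz : regular_at P (v * z ^+ j.+1) by apply: regularM => //;
    exact: regularX.
  split; first exact: regularD.
  rewrite valueD // valueM //; last exact: regularX.
  by rewrite exprS valueM ?zv ?mul0r ?mulr0 ?addr0 //; exact: regularX.
by rewrite expfzDr // mulrDl mulrA [v * _ * _]mulrAC.
Qed.

(** Orders of different parity are distinct, so the smaller one is the order of the sum. *)
Lemma has_order_even_odd (f g : K) n m :
  (f = 0 \/ has_order f (2 * n)) -> (g = 0 \/ has_order g (2 * m + 1)) ->
  f + g != 0 -> exists j, has_order (f + g) j.
Proof.
move=> [->|fn] [->|gm]; rewrite ?addr0 ?add0r ?eqxx // => _.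
- by exists (2 * m + 1).
- by exists (2 * n).
- have [lt_nm|gt_nm] : 2 * n < 2 * m + 1 \/ 2 * m + 1 < 2 * n by lia.
    by exists (2 * n); exact: has_order_lt lt_nm.
  by exists (2 * m + 1); rewrite addrC; exact: has_order_lt gt_nm.
Qed.

Lemma has_order_total (f : K) :
  (forall p, p != 0 -> exists n, has_order (polyfun p) n) ->
  (forall a b, polyfun a + polyfun b * y != 0 ->
     exists n, has_order (polyfun a + polyfun b * y) n) ->
  f != 0 -> exists n, has_order f n.
Proof.
move=> Hp Hab f0; have [a [b [d [d0 e]]]] := polyfun_repr f.
have pd0 : polyfun d != 0 by rewrite polyfun_eq0.
have -> : f = (polyfun a + polyfun b * y) * (polyfun d)^-1.
  by rewrite -e mulfK.
have [|n nab] := Hab a b; first by rewrite -e mulf_neq0.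
have [m md] := Hp d d0.
by exists (n - m); apply: has_orderM => //; exact: has_orderV.
Qed.

(* At a branch point of the double cover x, the functions in k(x) have even
   order and y has odd order. *)
Lemma has_order_total_ramified (f : K) m :
  (forall a, exists n, has_order (polyfun ('X - a%:P)) (2 * n)) ->
  has_order y (2 * m + 1) -> f != 0 -> exists n, has_order f n.
Proof.
move=> HX Hy.
have Hp p : p != 0 -> exists n, has_order (polyfun p) (2 * n).
  move=> p0; have [||a|n [j ->] pn] :=
    @has_order_polyfun (fun n => exists j, n = 2 * j) _ p0.
  - by exists 0.
  - by move=> _ _ [i ->] [j ->]; exists (i + j); rewrite mulrDr.
  - by have [n an] := HX a; exists (2 * n) => //; exists n.
  - by exists j.
apply: has_order_total => [p p0|a b]; first by have [n] := Hp p p0;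
  exists (2 * n).
have Ha : exists n, polyfun a = 0 \/ has_order (polyfun a) (2 * n).
  have [->|/Hp[n an]] := eqVneq a 0; first by exists 0; left; exact: polyfun0.
  by exists n; right.
have Hb : exists n, polyfun b * y = 0 \/ has_order (polyfun b * y) (2 * n + 1).
  have [->|/Hp[n an]] := eqVneq b 0.
    by exists 0; left; rewrite polyfun0 mul0r.
  by exists (n + m); right; rewrite mulrDr -addrA; exact: has_orderM.
have [n Ha'] := Ha; have [j Hb'] := Hb; exact: (has_order_even_odd Ha' Hb').
Qed.
End Factorization.

(** A factorization property that can be checked by hand and that implies the divisibility required
    by [uniformizer]; it also provides the existence of orders. *)
Definition splitting_uniformizer P z := [/\ z != 0, regular_at P z,
  value_at P z = 0 & forall f, f != 0 -> exists n, has_order P z f n].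

Lemma has_value_unit (P : curve_point C) f c : has_value P f c -> c != 0 ->
  local_unit P f.
Proof.
by move=> fc c0; split; [exact: has_value_regular fc | rewrite
  (has_value_at fc)].
Qed.

Section AffinePoint.
Variables (x0 y0 : k) (CP : on_curve C (Some (x0, y0))).
Let P : curve_point C := exist _ (Some (x0, y0)) CP.

Lemma has_value_polyfun p : has_value P (polyfun p) p.[x0].
Proof.
elim/poly_ind: p => [|p c IHp].
  by rewrite horner0 -polyC0; exact: has_value_constant.
rewrite polyfunD polyfunM hornerD hornerM hornerX hornerC.
apply: has_valueD; last exact: has_value_constant.
apply: has_valueM => //; rewrite -xfunE; exact: (has_value_coord P).1.
Qed.

Lemma has_value_ycoord : has_value P y y0.
Proof. by rewrite ycoordE; exact: (has_value_coord P).2. Qed.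

Lemma polyfun_unit p : p.[x0] != 0 -> local_unit P (polyfun p).
Proof. exact: has_value_unit (has_value_polyfun p). Qed.

(** Common factors x - x0 of a and b are split off by induction on the sizes. Once none is left, a +
    b y and a - b y do not both vanish at P: either a + b y is a unit, or it is its norm divided by
    the unit a - b y. *)
Lemma splitting_uniformizer_unramified : y0 != 0 ->
  splitting_uniformizer P (polyfun ('X - x0%:P)).
Proof.
move=> y00; set z := polyfun _.
have zP : has_value P z 0.
  by have := has_value_polyfun ('X - x0%:P); rewrite hornerXsubC subrr.
have z0 : z != 0 by rewrite polyfun_eq0 polyXsubC_eq0.
split => //; [exact: has_value_regular zP | exact: has_value_at zP |].
have Hp p : p != 0 -> exists n, has_order P z (polyfun p) n.
  move=> p0; have [||a|n _ pn] := @has_order_polyfun P z z0 (fun=> True) _ p0.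
  - by [].
  - by [].
  - have [->|ax] := eqVneq a x0; first by exists 1 => //;
      exact: has_order_uniformizer.
    exists 0 => //; apply/has_order_unit/polyfun_unit.
    by rewrite hornerXsubC subr_eq0 eq_sym.
  - by exists n.
move=> f; apply: has_order_total => // a b.
have [m] := ubnP (size a + size b)%N; elim: m => // m IHm in a b *.
move=> sab ab0; have [ax0|] := boolP (root a x0 && root b x0).
  have [/factor_theorem[a' ea] /factor_theorem[b' eb]] := andP ax0.
  have e : polyfun a + polyfun b * y = (polyfun a' + polyfun b' * y) * z.
    by rewrite ea eb !polyfunM -/z mulrAC -mulrDl.
  have ab0' : polyfun a' + polyfun b' * y != 0.
    by apply: contra_neq ab0; rewrite e => ->; rewrite mul0r.
  have [|//|n ab'n] := IHm a' b'.
    have szX p : size (p * ('X - x0%:P)) = (size p + (p != 0%R))%N.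
      have [->|p0] := eqVneq p 0; first by rewrite mul0r size_poly0.
      by rewrite size_Mmonic ?monicXsubC // size_XsubC addn2 addn1.
    have nz : (0 < (a' != 0%R) + (b' != 0%R))%N.
      rewrite addn_gt0 !lt0b -negb_and; apply: contraNN ab0' =>
        /andP[/eqP -> /eqP ->].
      by rewrite polyfun0 mul0r addr0.
    rewrite ea eb !szX addnACA in sab.
    by rewrite -ltnS; apply: leq_ltn_trans sab; rewrite -addn1 leq_add2l.
  by exists (n + 1); rewrite e; apply: has_orderM => //;
    exact: has_order_uniformizer.
rewrite negb_and => nroot.
have va : has_value P (polyfun a + polyfun b * y) (a.[x0] + b.[x0] * y0).
  apply: has_valueD; first exact: has_value_polyfun.
  by apply: has_valueM; [exact: has_value_polyfun | exact: has_value_ycoord].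
have vb : has_value P (polyfun a - polyfun b * y) (a.[x0] - b.[x0] * y0).
  rewrite -mulNr -[- polyfun b]sub0r -(polyfun0 C) -polyfunB sub0r.
  rewrite -[- (_ * y0)]mulNr -hornerN.
  apply: has_valueD; first exact: has_value_polyfun.
  by apply: has_valueM; [exact: has_value_polyfun | exact: has_value_ycoord].
have [va0|va0] := eqVneq (a.[x0] + b.[x0] * y0) 0; last first.
  by exists 0; apply/has_order_unit/(has_value_unit va).
(* If both conjugates vanished, then 2 a(x0) = 0 and b(x0) y0 = 0, and x0 would be a common root of
   a and b. *)
have vb0 : a.[x0] - b.[x0] * y0 != 0.
  apply: contraTneq nroot => vb0; rewrite negb_or !negbK.
  have ax0 : a.[x0] = 0.
    have : 2 * a.[x0] = (a.[x0] + b.[x0] * y0) + (a.[x0] - b.[x0] * y0) by ring.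
    by rewrite va0 vb0 addr0 => /eqP; rewrite mulf_eq0 (negPf two_neq0) => /eqP.
  move: va0; rewrite ax0 add0r => /eqP; rewrite mulf_eq0 (negPf y00) orbF =>
    bx0.
  by rewrite /root ax0 eqxx.
have g0 := local_unit_neq0 (has_value_unit vb vb0).
have e := polyfun_norm C a b.
have N0 : a ^+ 2 - cubic C * b ^+ 2 != 0.
  by rewrite -(polyfun_eq0 C) -e mulf_neq0.
have [n Nn] := Hp _ N0; exists n.
rewrite -[n]addr0 -[polyfun a + _](mulfK g0) e; apply: has_orderM => //.
by apply/has_order_unit/local_unitV/(has_value_unit vb).
Qed.

(** Here x0 is a simple root of the cubic, so y^2 = (x - x0) c with c a unit at P. *)
Lemma has_order_branch : y0 = 0 -> has_order P y (polyfun ('X - x0%:P)) 2.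
Proof.
move=> y00.
have root0 : x0 ^+ 3 + coef_a C * x0 + coef_b C = 0.
  have := on_curve_eq CP; rewrite y00 expr0n /= /cubic => /esym.
  by rewrite !hornerE.
pose c : {poly k} := 'X^2 + x0 *: 'X + (x0 ^+ 2 + coef_a C)%:P.
have cE : cubic C = ('X - x0%:P) * c.
  rewrite /cubic /c.
  have -> : coef_b C = - (x0 ^+ 3 + coef_a C * x0).
    by apply/eqP; rewrite -addr_eq0 addrC root0.
  rewrite -!mul_polyC !(polyCN, polyCD, polyCM, polyC_exp); ring.
have c0 : c.[x0] != 0.
  (* c(x0) is the derivative 3 x0^2 + a of the cubic at x0. If it were 0, then a = - 3 x0^2 and b =
     2 x0^3, so 4 a^3 + 27 b^2 = 0. *)
  apply: contra_neq (discriminant_neq0 C); 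
  rewrite !hornerD hornerZ hornerXn hornerX hornerC => cx0.
  have aE : coef_a C = (x0 ^+ 2 + x0 * x0 + (x0 ^+ 2 + coef_a C)) - 3 * x0 ^+ 2.
    by ring.
  have bE : coef_b C = (x0 ^+ 3 + coef_a C * x0 + coef_b C) -
    (x0 ^+ 3 + coef_a C * x0).
    by ring.
  by rewrite bE root0 aE cx0; ring.
exists (polyfun c)^-1; first exact/local_unitV/polyfun_unit.
have -> : y ^ 2 = polyfun ('X - x0%:P) * polyfun c.
  by rewrite -[y ^ 2]/(y ^+ 2) yfun_sqr cE polyfunM.
by rewrite mulrCA mulVf ?mulr1 // (local_unit_neq0 (polyfun_unit c0)).
Qed.

Lemma splitting_uniformizer_ramified : y0 = 0 ->
  splitting_uniformizer P y.
Proof.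
move=> y00.
have yP : has_value P y 0 by rewrite -y00; exact: has_value_ycoord.
split; [exact: ycoord_neq0 | exact: has_value_regular yP | exact: has_value_at
  yP |].
have y0' := ycoord_neq0 C.
move=> f; apply: (@has_order_total_ramified P y _ _ _ f 0);
  rewrite ?mulr0 ?add0r //.
- exact: has_value_regular yP.
- exact: has_value_at yP.
- move=> a; have [->|ax] := eqVneq a x0; last first.
    exists 0; rewrite mulr0; apply/has_order_unit/polyfun_unit.
    by rewrite hornerXsubC subr_eq0 eq_sym.
  by exists 1; rewrite mulr1; exact: has_order_branch.
- exact: has_order_uniformizer.
Qed.
End AffinePoint.

(** With s = x / y and w = 1 / y the Weierstrass equation becomes s^3 = w e, where e has value 1 at
    the origin. Hence y = e s^-3 and x = s y = e s^-2. *)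
Lemma has_order_origin : has_order O (polyfun 'X / y) y (- 3) /\
  forall a, has_order O (polyfun 'X / y) (polyfun ('X - a%:P)) (- 2).
Proof.
set s := polyfun 'X / y; set w := y^-1.
have y0 : y != 0 := ycoord_neq0 C.
have X0 : polyfun 'X != 0 by rewrite polyfun_eq0 polyX_eq0.
have sO : has_value O s 0.
  by have [+ _] := has_value_coord O; rewrite /= xfunE -ycoordE.
have wO : has_value O w 0.
  by have [_ +] := has_value_coord O; rewrite /= -ycoordE.
have s0 : s != 0 by rewrite mulf_neq0 ?invr_neq0.
pose e := 1 + const (- coef_a C) * (s * w) + const (- coef_b C) * (w * w).
have eO : has_value O e 1.
  have : has_value O e (1 + (- coef_a C) * (0 * 0) + (- coef_b C) * (0 * 0)).
    apply: has_valueD; first apply: has_valueD.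
    - by rewrite -(constant1 C); exact: has_value_constant.
    - apply: has_valueM; [exact: has_value_constant | exact: has_valueM].
    - apply: has_valueM; [exact: has_value_constant | exact: has_valueM].
  by rewrite mulr0 !mulr0 !addr0.
have eU : local_unit O e by apply: has_value_unit eO (oner_neq0 _).
have e0 := local_unit_neq0 eU.
have s3 : s ^+ 3 = w * e.
  rewrite /s /w /e !constantN; apply: weierstrass_at_origin => //.
  by rewrite yfun_sqr /cubic -mul_polyC !polyfunD polyfunM polyfunX.
have yE : y = e * (s ^+ 3)^-1.
  by rewrite s3 (invfM w e) mulrCA (mulfV e0) mulr1 /w invrK.
have xE : polyfun 'X = e * (s ^+ 2)^-1.
  have -> : polyfun 'X = s * y by rewrite divfK.
  rewrite yE.
  have id (F : fieldType) (u v : F) : u != 0 ->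
      u * (v * (u ^+ 3)^-1) = v * (u ^+ 2)^-1 by move=> u0; field.
  exact: id.
split; first by exists e.
(* x - a = (e - a s^2) s^-2, and the first factor still has value 1. *)
move=> a; exists (e - const a * s ^+ 2).
  apply: (@has_value_unit _ _ (1 + (- a) * (0 * 0))); last first.
    by rewrite mulr0 mulr0 addr0 oner_neq0.
  rewrite -mulNr -constantN expr2; apply: has_valueD => //.
  by apply: has_valueM; [exact: has_value_constant | exact: has_valueM].
rewrite -[s ^ _]/((s ^+ 2)^-1) polyfunB xE mulrBl mulfK //.
exact: expf_neq0.
Qed.

Lemma splitting_uniformizer_origin :
  splitting_uniformizer O (polyfun 'X / y).
Proof.
set s := polyfun 'X / y.
have sO : has_value O s 0.
  by have [+ _] := has_value_coord O; rewrite /= xfunE -ycoordE.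
have s0 : s != 0.
  by rewrite mulf_neq0 ?invr_neq0 ?ycoord_neq0 // polyfun_eq0 polyX_eq0.
have [ord_y ord_X] := has_order_origin.
split; [exact: s0 | exact: has_value_regular sO | exact: has_value_at sO |].
(* The order of y is - 3 = 2 * (- 2) + 1. *)
move=> f; apply: (@has_order_total_ramified O s _ _ _ f (- 2)).
- exact: s0.
- exact: has_value_regular sO.
- exact: has_value_at sO.
- by move=> a; exists (- 1); exact: ord_X.
- exact: ord_y.
Qed.

Lemma exists_splitting_uniformizer P : exists z, splitting_uniformizer P z.
Proof.
case: P => -[[x0 y0]|] CP.
  have [y00|y00] := eqVneq y0 0.
    by exists y; exact: splitting_uniformizer_ramified.
  by eexists; exact: splitting_uniformizer_unramified.
rewrite (_ : exist _ _ _ = O); last exact: val_inj.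
by eexists; exact: splitting_uniformizer_origin.
Qed.

End Uniformizers.

(** * Orders of vanishing *)

Section Divisors.
Variables (k : closedFieldType) (C : elliptic_curve k).
Hypothesis two_neq0 : (2 : k) != 0.
Local Notation K := (function_field C).
Local Notation y := (ycoord C).
Local Notation polyfun := (@polyfun k C).
Local Notation O := (@origin k C).
Local Notation const c := (polyfun c%:P).

Section Order.
Variable P : curve_point C.
Implicit Types (f g u z : K) (n m : int).

Lemma value_mul_eq0 f g : regular_at P f -> regular_at P g ->
  value_at P f = 0 -> value_at P (f * g) = 0.
Proof. by move=> fP gP f0; rewrite valueM // f0 mul0r. Qed.

Lemma splitting_uniformizerW z : splitting_uniformizer P z -> uniformizer P z.
Proof.
move=> [z0 zP zv zdec]; split => // f fP fv.
have [->|f0] := eqVneq f 0; first by exists 0; rewrite ?mulr0 //;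
  exact: regular0.
(* Exponent 0 would make f a unit, and a negative exponent would make u a multiple of f, so of value
   0. Only positive exponents remain. *)
have [[[|n]|n] [u [uP u0] e]] := zdec f f0.
- by move: u0; rewrite -[u]mulr1 -[1]/(z ^ 0) -e fv eqxx.
- exists (u * z ^+ n); first by apply: regularM => //; exact: regularX.
  by rewrite e mulrCA -exprS.
- move: u0; have -> : u = f * z ^+ n.+1.
    by rewrite e -[z ^ _]/((z ^+ n.+1)^-1) divfK // expf_neq0.
  by rewrite value_mul_eq0 ?eqxx //; exact: regularX.
Qed.

(** The definition of [uniformizer] does not exclude 0 outright, but z divides a splitting
    uniformizer, which is nonzero. *)
Lemma uniformizer_neq0 z : uniformizer P z -> z != 0.
Proof.
move=> [_ _ zdiv]; have [z' [z'0 z'P z'v _]] :=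
  exists_splitting_uniformizer two_neq0 P.
have [g _ e] := zdiv z' z'P z'v.
by apply: contra_neq z'0 => z0; rewrite e z0 mul0r.
Qed.

(** Each uniformizer divides the other, and the two quotients are inverse to each other. Orders
    therefore do not depend on the uniformizer. *)
Lemma uniformizer_unit z z' : uniformizer P z -> uniformizer P z' ->
  exists2 u, local_unit P u & z = u * z'.
Proof.
move=> zu zu'; have z0 := uniformizer_neq0 zu.
have [zP zv zdiv] := zu; have [zP' zv' zdiv'] := zu'.
have [g gP e] := zdiv' z zP zv; have [g' gP' e'] := zdiv z' zP' zv'.
have gg' : g' * g = 1.
  by apply: (mulfI z0); rewrite mulrA -e' -e mulr1.
exists g; last by rewrite mulrC.
split => //; apply: contra_eq_neq gg' => g0.
apply: contra_eq_neq (value1 P) => <-.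
by rewrite mulrC value_mul_eq0 // eq_sym oner_neq0.
Qed.

Lemma has_order_uniformizer_change z z' f n :
  uniformizer P z -> uniformizer P z' -> has_order P z f n ->
    has_order P z' f n.
Proof.
move=> zu zu' [u uP ->]; have [v vP ->] := uniformizer_unit zu zu'.
have v0 := local_unit_neq0 vP; have z0 := uniformizer_neq0 zu'.
exists (u * v ^ n); last by rewrite exprzMl ?unitfE // mulrA.
apply: local_unitM => //; case: n => n; first exact: local_unitX.
by apply: local_unitV; exact: local_unitX.
Qed.

Lemma has_order_inj z f n m :
  uniformizer P z -> has_order P z f n -> has_order P z f m -> n = m.
Proof.
move=> zu; have z0 := uniformizer_neq0 zu; have [zP zv _] := zu.
have main i j : i < j -> has_order P z f i -> has_order P z f j -> False.
  move=> ij [u [uP u0] e] [v [vP v0] e']; move: u0.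
  have [l jE] : exists l : nat, j = l.+1%:Z + i by exists `|j - i|%N.-1; lia.
  have -> : u = z * (v * z ^+ l).
    apply: (@mulIf _ (z ^ i)); first exact: expfz_neq0.
    by rewrite -e e' jE expfzDr // -[z ^ l.+1%:Z]/(z ^+ l.+1) exprS [LHS]mulrA
      [v * _]mulrCA.
  rewrite value_mul_eq0 ?eqxx //; apply: regularM => //; exact: regularX.
move=> fn fm; have [nm|mn|//] := ltgtP n m.
- by case: (main n m).
- by case: (main m n).
Qed.

Lemma ord_atE z f n : uniformizer P z -> has_order P z f n -> ord_at P f = n.
Proof.
move=> zu fn; apply: xget_unique.
  by have [u [uP u0] e] := fn; exists z, u.
move=> m [z' [u [zu' uP u0 e]]]; apply: (has_order_inj zu) fn.
by apply: (has_order_uniformizer_change zu' zu); exists u.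
Qed.

Lemma ord_atP z f : uniformizer P z -> f != 0 -> has_order P z f (ord_at P f).
Proof.
move=> zu f0; have [z' sz'] := exists_splitting_uniformizer two_neq0 P.
have zu' := splitting_uniformizerW sz'; have [_ _ _ /(_ f f0)[n fn]] := sz'.
by rewrite (ord_atE zu' fn); exact: has_order_uniformizer_change fn.
Qed.

Lemma exists_uniformizer : exists z, uniformizer P z.
Proof.
have [z zu] := exists_splitting_uniformizer two_neq0 P.
by exists z; exact: splitting_uniformizerW.
Qed.

Lemma ord_atM f g : f != 0 -> g != 0 -> ord_at P
  (f * g) = ord_at P f + ord_at P g.
Proof.
move=> f0 g0; have [z zu] := exists_uniformizer; apply: (ord_atE zu).
by apply: has_orderM; [exact: uniformizer_neq0 | exact: ord_atP | exact:
  ord_atP].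
Qed.

Lemma ord_atV f : f != 0 -> ord_at P f^-1 = - ord_at P f.
Proof.
move=> f0; have [z zu] := exists_uniformizer; apply: (ord_atE zu).
by apply: has_orderV; exact: ord_atP.
Qed.

Lemma ord_at_unit u : local_unit P u -> ord_at P u = 0.
Proof.
move=> uP; have [z zu] := exists_uniformizer; apply: (ord_atE zu).
exact: has_order_unit.
Qed.

Lemma ord_at_uniformizer z : uniformizer P z -> ord_at P z = 1.
Proof. by move=> zu; apply: (ord_atE zu); exact: has_order_uniformizer. Qed.

Lemma ord_atX f (n : nat) : f != 0 -> ord_at P (f ^+ n) = n%:Z * ord_at P f.
Proof.
move=> f0; elim: n => [|n IHn]; first by rewrite mul0r ord_at_unit //;
  exact: local_unit1.
by rewrite exprS ord_atM ?expf_neq0 // IHn; lia.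
Qed.

Lemma ord_atXz f n : f != 0 -> ord_at P (f ^ n) = n * ord_at P f.
Proof.
move=> f0; case: n => n; first exact: ord_atX.
rewrite -[f ^ _]/((f ^+ n.+1)^-1) ord_atV ?expf_neq0 // ord_atX //.
by rewrite NegzE mulNr.
Qed.

Lemma ord_at_ge0_regular f : f != 0 -> 0 <= ord_at P f -> regular_at P f.
Proof.
move=> f0; have [z zu] := exists_uniformizer; have [zP _ _] := zu.
have [u [uP _] e] := ord_atP zu f0; case: (ord_at P f) e => // n -> _.
by apply: regularM => //; exact: regularX.
Qed.

Lemma ord_at_eq0_unit f : f != 0 -> ord_at P f = 0 -> local_unit P f.
Proof.
move=> f0 e; have [z zu] := exists_uniformizer.
by have [u uP] := ord_atP zu f0; rewrite e expr0z mulr1 => ->.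
Qed.

End Order.

Definition opp_coords (P : option (k * k)) : option (k * k) :=
  if P is Some (a, b) then Some (a, - b) else None.

Lemma opp_coords_on_curve (P : curve_point C) : on_curve C (opp_coords (val P)).
Proof. by case: P => -[[a b]|] //=; rewrite sqrrN. Qed.

Definition opp_point (P : curve_point C) : curve_point C :=
  exist (fun Q => on_curve C Q) _ (opp_coords_on_curve P).

Lemma opp_pointK : involutive opp_point.
Proof. by move=> [[[a b]|] CP]; apply: val_inj => //=; rewrite opprK. Qed.

Lemma has_valueN (P : curve_point C) (f : K) c :
  has_value P f c -> has_value P (- f) (- c).
Proof.
move=> fc; rewrite -mulN1r -[- c]mulN1r -(constant1 C) -constantN.
by apply: has_valueM => //; exact: has_value_constant.
Qed.

Lemma conjugate_eval2 p (u v : K) :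
  conjugate (eval2 (Defs.constant C) p u v) =
  eval2 (Defs.constant C) p (conjugate u) (conjugate v).
Proof.
have conj_const c : conjugate (Defs.constant C c) = Defs.constant C c.
  by rewrite constantE conjugate_polyfun.
exact: (@rmorph_eval2 _ _ (Defs.constant C) (@conjugate k C) p u v conj_const).
Qed.

Lemma has_value_conj (P : curve_point C) (f : K) c :
  has_value P f c -> has_value (opp_point P) (conjugate f) c.
Proof.
have [coord1 coord2] :
    has_value (opp_point P) (conjugate (coord_fun P).1) (coord_val P).1 /\
    has_value (opp_point P) (conjugate (coord_fun P).2) (coord_val P).2.
  have := has_value_coord (opp_point P).
  case: P => -[[a b]|] CP; rewrite /= ?xfunE -?ycoordE => -[v1 v2].
    by rewrite conjugate_polyfun conjugate_yfun; split => //;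
      move: (has_valueN v2); rewrite opprK.
  (* At infinity both coordinates x / y and 1 / y change sign under conjugation, but their value 0
     does not. *)
  rewrite conjugateM !conjugateV conjugate_polyfun conjugate_yfun invrN mulrN
    -oppr0.
  by split; exact: has_valueN.
have conj_local p : has_value (opp_point P) (conjugate (local_fun P p))
  (poly_val P p).
  by rewrite local_funE /poly_fun conjugate_eval2; exact: has_value_eval2.
move=> [p [q [q0 -> ->]]]; rewrite conjugateM conjugateV.
by apply: has_valueM => //; exact: has_valueV.
Qed.

(** Conjugation carries the local ring at P onto the one at the opposite point, units to units and
    uniformizers to uniformizers. *)
Lemma ord_at_conj (P : curve_point C) (f : K) :
  f != 0 -> ord_at (opp_point P) (conjugate f) = ord_at P f.
Proof.
have unit_conj Q u : local_unit Q u -> local_unit (opp_point Q) (conjugate u).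
  move=> [/regular_atP uP u0]; exact: has_value_unit (has_value_conj uP) u0.
move=> f0; have [z zu] := exists_uniformizer P; have [u uP e] := ord_atP zu f0.
have [zP zv zdiv] := zu; move/regular_atP: (zP); rewrite zv => zP0.
have zu' : uniformizer (opp_point P) (conjugate z).
  split; [exact: has_value_regular (has_value_conj zP0) | |].
    exact: has_value_at (has_value_conj zP0).
  move=> g /regular_atP; move=> + g0; rewrite g0 => /has_value_conj.
  rewrite opp_pointK => gP.
  have [h /regular_atP hP gE] := zdiv _ (has_value_regular gP)
    (has_value_at gP).
  exists (conjugate h); first exact: has_value_regular (has_value_conj hP).
  by rewrite -[g]conjugateK gE conjugateM.
apply: (ord_atE zu'); exists (conjugate u); first exact: unit_conj.
rewrite {1}e; exact: etrans (conjugateM _ _) (congr1 _ (conjugateXz _ _)).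
Qed.

End Divisors.

(** * Principal divisors have degree 0 *)

(** Sums over a set on which the summand has infinite support are 0 by convention, so additivity is
    proved under this condition. *)
Definition finitely_supported (T : Type) (D : T -> int) :=
  finite_set [set P | D P != 0].

Section FiniteSupport.
Variable T : choiceType.
Implicit Types D : T -> int.

Lemma finitely_supportedD D D' : finitely_supported D ->
  finitely_supported D' ->
  finitely_supported (fun P => D P + D' P).
Proof.
move=> fD fD'; apply: (@sub_finite_set _ _
  ([set P | D P != 0] `|` [set P | D' P != 0])).
  move=> P /=; have [->|] := eqVneq (D P) 0; last by left.
  by rewrite add0r; right.
by rewrite finite_setU.
Qed.

Lemma finitely_supportedN D : finitely_supported D ->
  finitely_supported (fun P => - D P).
Proof. by apply: sub_finite_set => P /=; rewrite oppr_eq0. Qed.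

Lemma sum_finitely_supportedD D D' : finitely_supported D ->
  finitely_supported D' ->
  \sum_(P \in [set: T]) (D P + D' P) =
  \sum_(P \in [set: T]) D P + \sum_(P \in [set: T]) D' P.
Proof.
move=> fD fD'; pose S := [set P | D P != 0] `|` [set P | D' P != 0].
have fS : finite_set S by rewrite finite_setU.
have D0 P : ~ S P -> D P = 0.
  by move=> nS; apply: contrapT => /eqP DP; apply: nS; left.
have D0' P : ~ S P -> D' P = 0.
  by move=> nS; apply: contrapT => /eqP DP; apply: nS; right.
rewrite -!(@fsbig_widen _ _ _ _ S setT) //.
- exact: fsbig_split.
- by move=> P [_ nS] /=; exact: D0'.
- by move=> P [_ nS] /=; exact: D0.
- by move=> P [_ nS] /=; rewrite D0 // D0'.
Qed.

Lemma sum_finitely_supportedN D : finitely_supported D ->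
  \sum_(P \in [set: T]) (- D P) = - \sum_(P \in [set: T]) D P.
Proof.
move=> fD; apply/eqP; rewrite -subr_eq0 opprK addrC.
rewrite -sum_finitely_supportedD //; last exact: finitely_supportedN.
by apply/eqP; apply: fsbig1 => P _; rewrite subrr.
Qed.
End FiniteSupport.

Lemma polynomial_roots (k : closedFieldType) (p : {poly k}) :
  p != 0 -> exists s : seq k, forall a, root p a -> a \in s.
Proof.
move=> p0; have [s e] := closed_field_poly_normal p; exists s => a.
by rewrite e rootZ ?lead_coef_eq0 // root_prod_XsubC.
Qed.

Section PrincipalDivisors.
Variables (k : closedFieldType) (C : elliptic_curve k).
Hypothesis two_neq0 : (2 : k) != 0.
Local Notation K := (function_field C).
Local Notation y := (ycoord C).
Local Notation polyfun := (@polyfun k C).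
Local Notation O := (@origin k C).
Local Notation const c := (polyfun c%:P).

(** The origin is included because polynomials in x may have poles there. *)
Definition over_root (p : {poly k}) : set (curve_point C) :=
  [set P | P = O \/ exists x0 y0, val P = Some (x0, y0) /\ root p x0].

Lemma finite_over_root p : p != 0 -> finite_set (over_root p).
Proof.
move=> p0; have [rs rsP] := polynomial_roots p0.
have sq a : exists s : seq k, forall b, b ^+ 2 = a -> b \in s.
  have [|s sP] := @polynomial_roots k ('X^2 - a%:P).
  - by rewrite -size_poly_eq0 size_polyDl size_polyXn // size_polyN size_polyC;
      case: eqP.
  - by exists s => b ba; apply: sP; rewrite /root !hornerE ba subrr.
pose ss a := projT1 (cid (sq a)).
pose s := [:: None] ++ [seq Some (a, b) | a <- rs, b <- ss (cubic C).[a]].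
apply: (sub_finite_set _ (finite_seq (pmap insub s : seq (curve_point C)))).
move=> P oP; have insubE : (P \in pmap insub s) =
  (val P \in s) by exact: mem_pmap_sub.
suff Ps : val P \in s by rewrite /mkset insubE.
rewrite mem_cat inE; case: oP => [->//|[x0 [y0 [e px0]]]].
apply/orP; right; rewrite e; apply/allpairsPdep; exists x0, y0; split => //.
  exact: rsP.
rewrite /ss; case: cid => /= l lP; apply: lP.
by have := valP P; rewrite e => /eqP.
Qed.

(** Write f = (a + b y) / d. Where d and the norm of a + b y are units, a + b y is a regular factor
    of a unit, so f is a unit too. *)
Lemma local_unit_off_roots (f : K) : f != 0 -> exists2 p : {poly k}, p != 0 &
  forall P, ~ over_root p P -> local_unit P f.
Proof.
move=> f0; have [a [b [d [d0 e]]]] := polyfun_repr f.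
have fd0 : f * polyfun d != 0 by rewrite mulf_neq0 // polyfun_eq0.
have := polyfun_norm C a b; set N := a ^+ 2 - _ => eN.
have ab0 : polyfun a + polyfun b * y != 0 by rewrite -e.
have N0 : N != 0.
  rewrite -(polyfun_eq0 C) -eN mulf_neq0 //; apply: contra_neq ab0 => e0.
  have : polyfun a + polyfun (- b) * y = 0.
    by rewrite -[- b]sub0r polyfunB polyfun0 sub0r mulNr.
  by case/polyfun_pair_eq0 => -> /eqP; rewrite oppr_eq0 => /eqP ->;
    rewrite polyfun0 mul0r addr0.
exists (N * d); first by rewrite mulf_neq0.
move=> -[[[x0 y0]|] CP] nP; last by case: nP; left; exact: val_inj.
have : ~~ root (N * d) x0 by apply/negP => r; apply: nP; right; exists x0, y0.
rewrite rootM negb_or => /andP[Nx dx]; set P := exist _ _ _.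
have dU : local_unit P (polyfun d) by exact: polyfun_unit.
have NU : local_unit P (polyfun N) by exact: polyfun_unit.
have yP := has_value_regular (has_value_ycoord CP).
have pP q := has_value_regular (has_value_polyfun CP q).
have gP : regular_at P (polyfun a + polyfun b * y).
  by apply: regularD; [exact: pP | apply: regularM; [exact: pP | exact: yP]].
have hP : regular_at P (polyfun a - polyfun b * y).
  apply: regularD; first exact: pP.
  by apply: regularN; apply: regularM; [exact: pP | exact: yP].
have gU : local_unit P (polyfun a + polyfun b * y).
  split=> //; apply: contraNneq NU.2 => g0.
  by rewrite -eN value_mul_eq0.
rewrite -[f](mulfK (local_unit_neq0 dU)) e.
by apply: local_unitM => //; exact: local_unitV.
Qed.

Lemma finitely_supported_ord (f : K) : f != 0 -> finitely_supported (fun P =>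
  ord_at P f).
Proof.
move=> f0; have [p p0 pP] := local_unit_off_roots f0.
apply: sub_finite_set (finite_over_root p0) => P /=.
by move=> /eqP ordP; apply: contrapT => /pP/(ord_at_unit two_neq0).
Qed.

Local Notation divisor_degree D := (\sum_(P \in [set: curve_point C]) D P).

Lemma sum_ordM (f g : K) : f != 0 -> g != 0 ->
  divisor_degree (fun P => ord_at P (f * g)) =
  divisor_degree (fun P => ord_at P f) + divisor_degree (fun P => ord_at P g).
Proof.
move=> f0 g0; rewrite -sum_finitely_supportedD;
  [|exact: finitely_supported_ord..].
by apply: eq_fsbigr => P _; exact: ord_atM.
Qed.

(** The double pole at the origin is balanced by simple zeros at (a, b) and (a, - b), or by one
    double zero if b = 0. *)
Lemma sum_ord_XsubC a : divisor_degree (fun P =>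
  ord_at P (polyfun ('X - a%:P))) = 0.
Proof.
have ordO : ord_at O (polyfun ('X - a%:P)) = - 2.
  have [_ ordX] := has_order_origin C.
  apply: (ord_atE two_neq0 _ (ordX a)).
  by apply: splitting_uniformizerW; apply: splitting_uniformizer_origin.
have ord0 P : ~ over_root ('X - a%:P) P -> ord_at P (polyfun ('X - a%:P)) = 0.
  case: P => -[[x0 y0]|] CP nP; last by case: nP; left; exact: val_inj.
  apply: ord_at_unit => //; apply: polyfun_unit; apply/negP => r.
  by apply: nP; right; exists x0, y0.
have [b b2] : exists b, b ^+ 2 = (cubic C).[a].
  have /closed_rootP[b] : size ('X^2 - ((cubic C).[a])%:P) != 1%N.
    by rewrite size_polyDl size_polyXn // size_polyN size_polyC; case: eqP.
  by rewrite /root !hornerE subr_eq0 => /eqP; exists b.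
have Cb : on_curve C (Some (a, b)) by apply/eqP.
have Cb' : on_curve C (Some (a, - b)) by rewrite /= sqrrN; apply/eqP.
pose P1 : curve_point C := exist _ (Some (a, b)) Cb;
  pose P2 : curve_point C := exist _ (Some (a, - b)) Cb'.
have overP P : over_root ('X - a%:P) P -> [\/ P = O, P = P1 | P = P2].
  move=> [->|[x0 [y0 [e]]]]; first exact: Or31.
  rewrite root_XsubC => /eqP xa; rewrite xa in e.
  have := valP P; rewrite e /= -b2 => /eqP/eqP;
    rewrite eqf_sqr => /orP[/eqP yb|/eqP yb].
    by apply: Or32; apply: val_inj; rewrite e yb.
  by apply: Or33; apply: val_inj; rewrite e yb.
have [b0|b0] := eqVneq b 0.
  have eP : P2 = P1 by apply: val_inj; rewrite /= b0 oppr0.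
  have ord1 : ord_at P1 (polyfun ('X - a%:P)) = 2.
    apply: (ord_atE two_neq0 _ (has_order_branch Cb b0)).
    exact/splitting_uniformizerW/splitting_uniformizer_ramified.
  rewrite (@fsbigE _ _ _ _ _ [:: O; P1]) //.
  - by rewrite !big_cons big_nil !in_setT ordO ord1.
  - move=> P _; rewrite !inE negb_or => /andP[/eqP P0 /eqP nP1].
    by apply: ord0 => /overP[] //; rewrite eP.
have ord1 (u v : k) (Cuv : on_curve C (Some (u, v))) : v != 0 ->
    ord_at (exist _ (Some (u, v)) Cuv : curve_point C) (polyfun
      ('X - u%:P)) = 1.
  move=> v0; apply: ord_at_uniformizer => //.
  exact/splitting_uniformizerW/splitting_uniformizer_unramified.
rewrite (@fsbigE _ _ _ _ _ [:: O; P1; P2]) //.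
- rewrite !big_cons big_nil !in_setT ordO /P1 /P2 !ord1 //.
  by rewrite oppr_eq0.
- rewrite /= !inE andbT -[P1 == P2]/(Some (a, b) == Some (a, - b)).
  apply/negP => /eqP[] /eqP; rewrite -subr_eq0 opprK -mulr2n -mulr_natl.
  by rewrite mulf_eq0 (negPf two_neq0) (negPf b0).
- move=> P _; rewrite !inE !negb_or => /and3P[/eqP P0 /eqP nP1 /eqP nP2].
  by apply: ord0 => /overP[].
Qed.

Lemma sum_ord_polyfun p : p != 0 -> divisor_degree (fun P =>
  ord_at P (polyfun p)) = 0.
Proof.
move=> p0; have [s ->] := closed_field_poly_normal p.
have c0 : lead_coef p != 0 by rewrite lead_coef_eq0.
rewrite -mul_polyC polyfunM sum_ordM; last 2 first.
- by rewrite polyfun_eq0 polyC_eq0.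
- by rewrite polyfun_eq0 monic_neq0 // monic_prod_XsubC.
rewrite [X in X + _]fsbig1 ?add0r => [|P _]; last first.
  by apply: ord_at_unit => //; exact: local_unit_constant.
elim: s => [|a s IHs].
  rewrite big_nil polyfun1; apply: fsbig1 => P _.
  by apply: ord_at_unit => //; exact: local_unit1.
rewrite big_cons polyfunM sum_ordM ?polyfun_eq0 ?polyXsubC_eq0 //.
  by rewrite IHs sum_ord_XsubC.
by rewrite monic_neq0 // monic_prod_XsubC.
Qed.

Theorem sum_ord_eq0 (f : K) : f != 0 -> divisor_degree (fun P =>
  ord_at P f) = 0.
Proof.
move=> f0; have [a [b [d [d0 e]]]] := polyfun_repr f.
have pd0 : polyfun d != 0 by rewrite polyfun_eq0.
have g0 : polyfun a + polyfun b * y != 0 by rewrite -e mulf_neq0.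
set g := polyfun a + _ in e g0.
have cg : conjugate g = polyfun a - polyfun b * y.
  by rewrite conjugateD conjugateM !conjugate_polyfun conjugate_yfun mulrN.
have cg0 : conjugate g != 0 by apply: contra_neq g0 => cg0;
  rewrite -[g]conjugateK cg0 rmorph0.
have sum_g : divisor_degree (fun P => ord_at P g) = divisor_degree (fun P =>
  ord_at P f).
  by rewrite -e sum_ordM // sum_ord_polyfun // addr0.
have sum_cg : divisor_degree (fun P => ord_at P (conjugate g)) =
    divisor_degree (fun P => ord_at P g).
  rewrite (reindex_fsbigT (@opp_point k C));
    last exact: inv_bij (@opp_pointK k C).
  by apply: eq_fsbigr => P _; exact: ord_at_conj.
have := sum_ordM g0 cg0; rewrite sum_cg sum_g cg polyfun_norm sum_ord_polyfun.
  by lia.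
by rewrite -(polyfun_eq0 C) -polyfun_norm -cg mulf_neq0.
Qed.

End PrincipalDivisors.

(** * Twisting a line bundle by a divisor *)

Section LocalMatrices.
Variables (k : closedFieldType) (C : elliptic_curve k) (P : curve_point C).
Local Notation K := (function_field C).

Lemma regular_sum (I : Type) (r : seq I) (F : I -> K) :
  (forall i, regular_at P (F i)) -> regular_at P (\sum_(i <- r) F i).
Proof.
move=> FP; elim: r => [|i r IHr]; first by rewrite big_nil; exact: regular0.
by rewrite big_cons; exact: regularD.
Qed.

Lemma value_sum (I : Type) (r : seq I) (F : I -> K) :
  (forall i, regular_at P (F i)) ->
  value_at P (\sum_(i <- r) F i) = \sum_(i <- r) value_at P (F i).
Proof.
move=> FP; elim: r => [|i r IHr]; first by rewrite !big_nil value0.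
by rewrite !big_cons valueD ?IHr //; exact: regular_sum.
Qed.

Lemma regular_mxM m n p (A : 'M[K]_(m, n)) (B : 'M[K]_(n, p)) :
  regular_mx_at P A -> regular_mx_at P B -> regular_mx_at P (A *m B).
Proof.
by move=> AP BP i j; rewrite mxE; apply: regular_sum => l; exact: regularM.
Qed.

Lemma value_mxM m n p (A : 'M[K]_(m, n)) (B : 'M[K]_(n, p)) :
  regular_mx_at P A -> regular_mx_at P B ->
  value_mx_at P (A *m B) = value_mx_at P A *m value_mx_at P B.
Proof.
move=> AP BP; apply/matrixP => i j; rewrite !mxE value_sum => [|l].
  by apply: eq_bigr => l _; rewrite !mxE valueM.
exact: regularM.
Qed.

Lemma regular_mxZ m n a (A : 'M[K]_(m, n)) :
  regular_at P a -> regular_mx_at P A -> regular_mx_at P (a *: A).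
Proof. by move=> aP AP i j; rewrite mxE; exact: regularM. Qed.

Lemma value_mxZ m n a (A : 'M[K]_(m, n)) :
  regular_at P a -> regular_mx_at P A ->
  value_mx_at P (a *: A) = value_at P a *: value_mx_at P A.
Proof. by move=> aP AP; apply/matrixP => i j; rewrite !mxE valueM. Qed.

End LocalMatrices.

Section Bundles.
Variables (k : closedFieldType) (C : elliptic_curve k).
Hypothesis two_neq0 : (2 : k) != 0.
Local Notation K := (function_field C).
Local Notation O := (@origin k C).
Local Notation divisor_degree D := (\sum_(P \in [set: curve_point C]) D P).

Lemma trans_inv r (E : bundle C r) i j : trans (b := E) i j *m trans j i = 1%:M.
Proof. by rewrite trans_cocycle trans_id. Qed.

Lemma line_trans_neq0 (L : bundle C 1) i j : trans (b := L) i j 0 0 != 0.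
Proof.
apply: contra_eq_neq (trans_inv i j) => t0; apply/eqP => /matrixP/(_ 0 0).
by rewrite !mxE big_ord1 t0 mul0r eqxx => /esym/eqP; rewrite oner_eq0.
Qed.

Lemma line_trans_unit (L : bundle C 1) (i j : chart L) P :
  dom i P -> dom j P -> local_unit P (trans i j 0 0).
Proof.
move=> iP jP; have rij := trans_regular iP jP 0 0.
have rji := trans_regular jP iP 0 0; split => //.
apply: contra_eq_neq (value1 P) => v0.
have <- : trans i j 0 0 * trans j i 0 0 = 1.
  by have /matrixP/(_ 0 0) := trans_inv i j; rewrite !mxE big_ord1.
by rewrite value_mul_eq0 // eq_sym oner_neq0.
Qed.

Lemma finitely_supported_line (L : bundle C 1) :
  finitely_supported (fun P => ord_at P (\det (trans (chart_at L P)
    (chart_at L O)))).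
Proof.
apply: sub_finite_set (dom_open (chart_at L O)) => P /= /eqP nP;
  apply: contra_not nP.
move=> OP; rewrite det_mx11; apply: ord_at_unit => //.
by apply: line_trans_unit => //; exact: dom_chart_at.
Qed.

Section Twist.
Variables (L : bundle C 1) (r : nat) (E : bundle C r) (f : bundle_mor L E).
Variables (m : curve_point C -> int) (h : curve_point C -> K).
(* h P is an equation at P of the divisor m, and the generator of L(m) near P is
   that of L divided by h P. *)
Hypotheses (fin_m : finitely_supported m) (h0 : forall P, h P != 0).
Hypothesis ord_h : forall P, ord_at P (h P) = m P.
Hypothesis twist_regular : forall P, regular_mx_at P
  ((h P)^-1 *: mor_mx f (chart_at E P) (chart_at L P)).

(** Where [h P] is still an equation of m, so that the quotients [h P / h Q] are regular on
    overlaps. *)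
Definition twist_dom P : set (curve_point C) :=
  [set Q | dom (chart_at L P) Q /\ ord_at Q (h P) = m Q].

Definition twist_trans P Q : 'M[K]_1 :=
  (h P / h Q) *: trans (chart_at L P) (chart_at L Q).

Lemma twist_dom_open P : finite_set (~` twist_dom P).
Proof.
apply: (@sub_finite_set _ _ (~` dom (chart_at L P) `|`
    ([set Q | ord_at Q (h P) != 0] `|` [set Q | m Q != 0]))).
  move=> Q nQ /=; apply: contrapT => /not_orP[/contrapT LQ].
  move=> /not_orP[/negP/negPn/eqP hQ /negP/negPn/eqP mQ].
  by apply: nQ; split => //; rewrite hQ mQ.
rewrite !finite_setU; split; first exact: dom_open.
by split => //; apply: finitely_supported_ord => //; exact: h0.
Qed.

Lemma twist_ratio_regular P P' Q : ord_at Q (h P) = ord_at Q (h P') ->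
  regular_at Q (h P / h P').
Proof.
move=> e.
have d0 : h P / h P' != 0 by rewrite mulf_neq0 ?invr_neq0.
have hV0 : (h P')^-1 != 0 by rewrite invr_neq0.
apply: (ord_at_ge0_regular two_neq0 d0).
by rewrite (ord_atM two_neq0 Q (h0 P) hV0) (ord_atV two_neq0 Q (h0 P')) e subrr.
Qed.

Lemma twist_trans_regular P P' Q : twist_dom P Q -> twist_dom P' Q ->
  regular_mx_at Q (twist_trans P P').
Proof.
move=> [PQ hP] [PQ' hP']; apply: regular_mxZ; last exact: trans_regular.
by apply: twist_ratio_regular; rewrite hP hP'.
Qed.

Lemma twist_ratioM P P' Q : (h P / h P') * (h P' / h Q) = h P / h Q.
Proof. by rewrite mulrA divfK ?h0. Qed.

Definition twist_bundle : bundle C 1.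
Proof.
refine (@Bundle _ _ 1 (curve_point C) twist_dom id twist_trans _ _ _ _ _).
- exact: twist_dom_open.
- by move=> P; split; [exact: dom_chart_at | exact: ord_h].
- exact: twist_trans_regular.
- by move=> P; rewrite /twist_trans divff ?h0 // scale1r trans_id.
- move=> P P' Q; rewrite /twist_trans -scalemxAl -scalemxAr scalerA.
  by rewrite twist_ratioM trans_cocycle.
Defined.

Definition twist_mx (j : chart E) (P : curve_point C) : 'M[K]_(r, 1) :=
  (h P)^-1 *: mor_mx f j (chart_at L P).

Lemma twist_mx_change j P Q : twist_mx j P =
  trans j (chart_at E Q) *m twist_mx (chart_at E Q) Q *m twist_trans Q P.
Proof.
rewrite /twist_mx /twist_trans -!scalemxAr -scalemxAl mor_trans scalerA.
by rewrite mulrAC divff ?mul1r ?h0.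
Qed.

(** [twist_regular] concerns only the chart of each point at that point; transition matrices carry
    regularity to all other charts. *)
Lemma twist_mx_regular (j : chart E) (P Q : curve_point C) :
  dom j Q -> twist_dom P Q -> regular_mx_at Q (twist_mx j P).
Proof.
move=> jQ PQ; rewrite (twist_mx_change j P Q); apply: regular_mxM.
  apply: regular_mxM; last exact: twist_regular.
  by apply: trans_regular => //; exact: dom_chart_at.
apply: twist_trans_regular => //; split; [exact: dom_chart_at | exact: ord_h].
Qed.

Definition twist_mor : bundle_mor twist_bundle E.
Proof.
refine (@Morphism _ _ _ _ twist_bundle E twist_mx _ _).
- exact: twist_mx_regular.
- move=> j' j P P'; rewrite /= /twist_mx /twist_trans.
  rewrite -!scalemxAr -scalemxAl mor_trans scalerA.
  by rewrite mulrAC divff ?mul1r ?h0.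
Defined.

(** The transition to the chart at the origin acquires the factor [h P / h O]. At P the numerator
    contributes m P, while [h O] is one global function, with divisor of degree 0. *)
Lemma degree_twist : degree twist_bundle = degree L + divisor_degree m.
Proof.
have e P : ord_at P (\det (twist_trans P O)) =
    (ord_at P (\det (trans (chart_at L P) (chart_at L O))) + m P) +
    - ord_at P (h O).
  have hV0 : (h O)^-1 != 0 by rewrite invr_neq0.
  rewrite !det_mx11 mxE (ord_atM two_neq0) ?mulf_neq0 ?line_trans_neq0 //.
  by rewrite (ord_atM two_neq0) // (ord_atV two_neq0) // ord_h addrC addrA.
rewrite /degree (eq_fsbigr (fun P => (ord_at P (\det (trans (chart_at L P)
  (chart_at L O))) + m P) + - ord_at P (h O))); last by move=> P _; exact: e.
have fL := finitely_supported_line L.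
have fh := finitely_supported_ord two_neq0 (h0 O).
rewrite sum_finitely_supportedD; [|exact: finitely_supportedD|exact:
  finitely_supportedN].
rewrite sum_finitely_supportedD // sum_finitely_supportedN // sum_ord_eq0 //.
by rewrite subr0.
Qed.

End Twist.

Lemma chart_mor_neq0 (r s : nat) (F : bundle C r) (E : bundle C s)
    (f : bundle_mor F E) j i : nonzero_mor f -> mor_mx f j i != 0.
Proof.
move=> [j' [i' f0]]; apply: contra_neq f0 => f0.
by rewrite -(mor_trans f j' j i i') f0 mulmx0 mul0mx.
Qed.

End Bundles.

(** * The degree of E_1 *)

Lemma finitely_supported_count (T : choiceType) (s : seq T) :
  finitely_supported (fun P => (count_mem P s)%:Z).
Proof.
apply: sub_finite_set (finite_seq s) => P /= nP.
by rewrite -has_pred1 has_count lt0n; apply: contra nP => /eqP ->.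
Qed.

Lemma sum_count (T : choiceType) (s : seq T) :
  \sum_(P \in [set: T]) (count_mem P s)%:Z = (size s)%:Z.
Proof.
elim: s => [|Q s IHs]; first by apply: fsbig1.
transitivity (\sum_(P \in [set: T]) ((count_mem P [:: Q])%:Z +
  (count_mem P s)%:Z)).
  by apply: eq_fsbigr => P _ /=; rewrite addn0 PoszD.
rewrite sum_finitely_supportedD; [|exact: finitely_supported_count..].
rewrite IHs (@fsbigE _ _ _ _ _ [:: Q]) //.
  by rewrite big_cons big_nil in_setT /= eqxx addr0.
by move=> P _; rewrite inE /= eq_sym => /negPf ->.
Qed.

Lemma sum_ord2 (V : nmodType) (F : 'I_2 -> V) : \sum_(i < 2) F i = F 0 + F 1.
Proof.
by rewrite !big_ord_recl big_ord0 addr0; congr (_ + F _); apply: val_inj.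
Qed.

Lemma ord2P (Q : 'I_2 -> Prop) : Q 0 -> Q 1 -> forall i, Q i.
Proof.
move=> Q0 Q1 -[[|[|//]] i2].
  by rewrite (_ : Ordinal i2 = 0) //; apply: val_inj.
by rewrite (_ : Ordinal i2 = 1) //; apply: val_inj.
Qed.

Lemma det_mx22 (R : comNzRingType) (A : 'M[R]_2) :
  \det A = A 0 0 * A 1 1 - A 0 1 * A 1 0.
Proof.
rewrite (expand_det_row _ 0) sum_ord2 /cofactor !det_mx11 !mxE.
have -> : lift 0 0 = 1 :> 'I_2 by apply: val_inj.
have -> : lift 1 0 = 0 :> 'I_2 by apply: val_inj.
by rewrite /= expr0 expr1 mul1r mulN1r mulrN.
Qed.

(** The Gram matrix of the determinant form. The row [v^T *m symplectic2] is (- v_1, v_0), which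
    annihilates v. *)
Definition symplectic2 {R : nzRingType} : 'M[R]_2 :=
  \matrix_(i, j) ((j : nat)%:R - (i : nat)%:R).

(** A change of frame T multiplies the determinant form by det T; this is how the determinants in
    [degree] are reached from columns. *)
Lemma symplectic2_det (R : comNzRingType) (T : 'M[R]_2) :
  T^T *m symplectic2 *m T = \det T *: symplectic2.
Proof.
rewrite det_mx22; apply/matrixP => i j.
move: j; apply: ord2P; move: i; apply: ord2P;
  rewrite !mxE !sum_ord2 !mxE !sum_ord2 !mxE /=; ring.
Qed.

Lemma symplectic2_orthogonal (F : fieldType) (v : 'cV[F]_2) (w : 'rV[F]_2) :
  v != 0 -> w *m v = 0 -> exists a, w = a *: (v^T *m symplectic2).
Proof.
move=> v0 /matrixP/(_ 0 0); rewrite !mxE sum_ord2 => wv.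
have [v00|v00] := eqVneq (v 0 0) 0.
  have v10 : v 1 0 != 0.
    apply: contra_neq v0 => v10; apply/matrixP => i j; rewrite ord1 mxE.
    by move: i; apply: ord2P.
  have w1 : w 0 1 = 0.
    by apply/eqP; move/eqP: wv; rewrite v00 mulr0 add0r mulf_eq0
      (negPf v10) orbF.
  exists (- (w 0 0 / v 1 0)); apply/matrixP => i; rewrite ord1 {i}.
  apply: ord2P; rewrite !mxE sum_ord2 !mxE v00 ?w1 /= -[(1 %% 2)%N]/1%N;
    by field.
exists (w 0 1 / v 0 0); apply/matrixP => i; rewrite ord1 {i}.
have w0 : w 0 0 = - (w 0 1 * v 1 0) / v 0 0.
  by apply: (mulIf v00); rewrite divfK //; apply/eqP; rewrite -addr_eq0 wv.
apply: ord2P; rewrite !mxE sum_ord2 !mxE ?w0 /= -[(1 %% 2)%N]/1%N; by field.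
Qed.

Lemma symplectic2_rowE (R : nzRingType) (v : 'cV[R]_2) :
  ((v^T *m symplectic2) 0 0 = - v 1 0) * ((v^T *m symplectic2) 0 1 = v 0 0).
Proof.
rewrite !mxE !sum_ord2 !mxE /= -[(1 %% 2)%N]/1%N.
by rewrite !(subr0, subrr, sub0r, mulr1, mulr0, addr0, add0r) mulrN mulr1.
Qed.

Lemma symplectic2_eq0 (R : nzRingType) (v : 'cV[R]_2) :
  (v^T *m symplectic2 == 0) = (v == 0).
Proof.
apply/eqP/eqP => [/matrixP e|->]; last by rewrite trmx0 mul0mx.
have := e 0 0; have := e 0 1; rewrite !symplectic2_rowE !mxE => e0 /eqP.
rewrite oppr_eq0 => /eqP e1; apply/matrixP => i j; rewrite ord1 mxE.
by move: i; apply: ord2P.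
Qed.

Section Degree.
Variables (k : closedFieldType) (C : elliptic_curve k).
Hypothesis two_neq0 : (2 : k) != 0.
Local Notation K := (function_field C).
Local Notation O := (@origin k C).
Local Notation divisor_degree D := (\sum_(P \in [set: curve_point C]) D P).

(** As in Euclid's argument, the product of the x - x(Q) plus 1 has a root, which is the abscissa of
    no listed point Q. *)
Lemma infinite_curve (A : set (curve_point C)) : finite_set A ->
  exists P, ~ A P.
Proof.
move=> /finite_seqP[s ->].
(* Listing the origin, with [coord_val] (0, 0), keeps q nonconstant when s is empty. *)
pose q : {poly k} := \prod_(Q <- O :: s) ('X - ((coord_val Q).1)%:P) + 1.
have /closed_rootP[a] : size q != 1%N.
  have szp : size (\prod_(Q <- O :: s) ('X - ((coord_val Q).1)%:P)) =
    (size s).+2.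
    by rewrite -(big_map (fun Q => (coord_val Q).1) xpredT (fun c =>
      'X - c%:P));
      rewrite size_prod_XsubC size_map.
  by rewrite size_polyDl szp // size_poly1.
rewrite rootE hornerD horner_prod hornerC => qa.
have /closed_rootP[b] : size ('X^2 - ((cubic C).[a])%:P) != 1%N.
  by rewrite size_polyDl size_polyXn // size_polyN size_polyC; case: eqP.
rewrite rootE hornerD hornerXn hornerN hornerC subr_eq0 => Cab.
exists (exist _ (Some (a, b)) Cab : curve_point C) => /= sP.
move: qa; rewrite (big_rem (exist _ (Some (a, b)) Cab : curve_point C)) /=.
  by rewrite hornerXsubC subrr mul0r add0r oner_eq0.
by rewrite inE sP orbT.
Qed.


Lemma local_unit_cofinite (f : K) : f != 0 ->
  exists2 A : set (curve_point C), finite_set A & forall P, ~ A P ->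
    local_unit P f.
Proof.
move=> f0; exists [set P | ord_at P f != 0].
  exact: (finitely_supported_ord two_neq0 f0).
by move=> P /= /negP/negPn/eqP; exact: ord_at_eq0_unit.
Qed.

Lemma mor_mx_regular r s (E : bundle C r) (F : bundle C s)
  (f : bundle_mor E F) P :
  regular_mx_at P (mor_mx f (chart_at F P) (chart_at E P)).
Proof. by apply: mor_regular; exact: dom_chart_at. Qed.

(** y / x is the inverse of a uniformizer at the origin, so it has order - 1 there, whereas the
    quotient is 1 there. The divisor of O(w) is thus w plus a principal divisor. *)
Lemma ord_origin_generator P :
  ord_at P (origin_generator C (O == O) / origin_generator C (P == O)) =
  ord_at P (origin_generator C true) + (count_mem P [:: O])%:Z.
Proof.
have gen0 := origin_generator_neq0 C; have xO : ord_at O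
  (origin_generator C true) = - 1.
  have -> : origin_generator C true = (polyfun C 'X / ycoord C)^-1.
    by rewrite invf_div /= xfunE ycoordE.
  rewrite ord_atV //; last first.
    by rewrite mulf_neq0 ?invr_neq0 ?ycoord_neq0 // polyfun_eq0 polyX_eq0.
  rewrite (ord_at_uniformizer two_neq0) //.
  by apply: splitting_uniformizerW; apply: splitting_uniformizer_origin.
rewrite eqxx; have [->|PO] := eqVneq P O.
  rewrite divff // xO; apply: ord_at_unit => //; exact: local_unit1.
have -> : count_mem P [:: O] = 0%N by rewrite /= eq_sym (negPf PO).
by rewrite divr1 addr0.
Qed.

Theorem degree_E1 (E : bundle C 2) : is_E1 E -> degree E = 1.
Proof.
move=> [f [g [exact_fg _]]].
pose F P : 'cV[K]_2 := mor_mx f (chart_at E P) (chart_at (trivial_line C) P).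
pose G P : 'rV[K]_2 := mor_mx g (chart_at (origin_line C) P) (chart_at E P).
have FP P : regular_mx_at P (F P) := mor_mx_regular f P.
have GP P : regular_mx_at P (G P) := mor_mx_regular g P.
have F0 P : value_mx_at P (F P) != 0.
  have [inj _ _] := exact_fg P.
  apply/eqP => F0; have /matrixP/(_ 0 0) :=
    inj 1%:M (etrans (congr1 (mulmx^~ _) F0) (mul0mx _ _)).
  by rewrite !mxE => /eqP; rewrite oner_eq0.
have GF P : value_mx_at P (G P) *m value_mx_at P (F P) = 0.
  have [_ ex _] := exact_fg P; apply/(ex _); exists 1%:M; by rewrite mulmx1.
have G0 P : value_mx_at P (G P) != 0.
  have [_ _ surj] := exact_fg P; have [v] := surj 1%:M.
  apply: contra_eq_neq => G0; rewrite /fibre_mor -/(G P) G0 mul0mx.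
  by apply/eqP => /matrixP/(_ 0 0); rewrite !mxE => /eqP; rewrite oner_eq0.
pose T P : 'M[K]_2 := trans (chart_at E P) (chart_at E O).
pose tau P : K := origin_generator C (O == O) / origin_generator C (P == O).
have FT P : F P = T P *m F O.
  by rewrite -[F P](mor_trans f _ (chart_at E O) tt tt) mulmx1.
have GT P : G P *m T P = tau P *: G O.
  rewrite -[G P](mor_trans g _ (O == O) (chart_at E O) _) -mulmxA trans_inv
    mulmx1.
  by rewrite /= mul_scalar_mx.
have gen0 := origin_generator_neq0 C.
have tau0 P : tau P != 0 by rewrite mulf_neq0 ?invr_neq0.
(* Exactness on fibres only says that G P F P has value 0 at P. Were G O F O nonzero as a rational
   function, it and tau P would both be units at P for all but finitely many P, and the curve is
   infinite. *)
have GFO : G O *m F O = 0.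
  apply/eqP; apply: contrapT => /negP GF0.
  have GF00 : (G O *m F O) 0 0 != 0.
    by apply: contra_neq GF0 => e; apply/matrixP => i j; rewrite !ord1 e mxE.
  have [A1 fA1 A1P] := local_unit_cofinite GF00.
  have [A2 fA2 A2P] : exists2 A : set (curve_point C), finite_set A &
      forall P, ~ A P -> ord_at P (tau P) = 0.
    exists ([set P | ord_at P (origin_generator C true) != 0] `|` [set O]).
      rewrite finite_setU; split; last exact: finite_set1.
      exact: (finitely_supported_ord two_neq0 (gen0 true)).
    move=> P /= /not_orP[/negP/negPn/eqP e /eqP PO].
    by rewrite ord_origin_generator e /= eq_sym (negPf PO).
  have fA : finite_set (A1 `|` A2) by rewrite finite_setU.
  have [P /not_orP[nA1 nA2]] := infinite_curve fA.
  have tauU := ord_at_eq0_unit two_neq0 (tau0 P) (A2P P nA2).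
  have := (local_unitM tauU (A1P P nA1)).2.
  have -> : tau P * (G O *m F O) 0 0 = (G P *m F P) 0 0.
    by rewrite (FT P) mulmxA GT -scalemxAl [RHS]mxE.
  have /matrixP/(_ 0 0) := GF P; rewrite -value_mxM //; rewrite !mxE => ->.
  by rewrite eqxx.
pose N P : 'rV[K]_2 := (F P)^T *m symplectic2.
have NT P : N P *m T P = \det (T P) *: N O.
  by rewrite /N {1}(FT P) trmx_mul -!mulmxA [X
    in _ *m X]mulmxA symplectic2_det -scalemxAr.
have FP0 P : F P != 0.
  by apply: contra_neq (F0 P) => ->; apply/matrixP => i j; rewrite !mxE value0.
have GFP P : G P *m F P = 0 by rewrite (FT P) mulmxA GT -scalemxAl GFO scaler0.
(* G P and (F P)^T J both span the annihilator of F P, and neither vanishes at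
   P, so they differ by a local unit; comparing the charts at P and O then
   relates det E to O(w). *)
have [lam GN] : exists lam : curve_point C -> K, forall P, G P = lam P *: N P.
  have lamP P := cid (symplectic2_orthogonal (FP0 P) (GFP P)).
  by exists (fun P => projT1 (lamP P)) => P; case: (lamP P).
have N00 : N O != 0 by rewrite symplectic2_eq0.
have rel P : lam P * \det (T P) = tau P * lam O.
  have : (lam P * \det (T P)) *: N O = (tau P * lam O) *: N O.
    by rewrite -scalerA -NT scalemxAl -GN GT GN scalerA.
  move=> /eqP; rewrite -subr_eq0 -scalerBl scaler_eq0 (negPf N00) orbF subr_eq0.
  by move/eqP.
have NP P : regular_mx_at P (N P).
  move=> i; rewrite ord1 {i}; apply: ord2P; rewrite symplectic2_rowE.
    exact: regularN (FP P 1 0).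
  exact: FP.
have N0 P : exists j, local_unit P (N P 0 j).
  have : exists i, value_at P (F P i 0) != 0.
    apply: contrapT => nF; move/eqP: (F0 P); apply; apply/matrixP => i j.
    rewrite ord1 !mxE; apply: contrapT => /eqP Fi; apply: nF; by exists i.
  move=> [i Fi]; move: i Fi; apply: ord2P => Fi.
    by exists 1; rewrite symplectic2_rowE; split => //; exact: FP.
  exists 0; rewrite symplectic2_rowE; split; first exact: regularN (FP P 1 0).
  rewrite -mulN1r -(constant1 C) -constantN valueM;
    [|exact: regular_constant|exact: FP].
  by rewrite value_constant mulN1r oppr_eq0.
(* [lam P] is regular because N P has a unit entry, and its value is nonzero because otherwise G P
   would vanish at P. *)
have lam_unit P : local_unit P (lam P).
  have lamP : regular_at P (lam P).
    have [j NU] := N0 P.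
    have -> : lam P = G P 0 j * (N P 0 j)^-1.
      by rewrite GN mxE mulfK //; exact: local_unit_neq0 NU.
    by apply: regularM; [exact: GP | exact: (local_unitV NU).1].
  split => //; apply: contraNneq (G0 P) => lam0; apply/eqP/matrixP => i j.
  rewrite ord1 !mxE GN mxE; apply: value_mul_eq0 => //; exact: NP.
have detT0 P : \det (T P) != 0.
  apply: contra_eq_neq (rel P) => ->; rewrite mulr0 eq_sym mulf_neq0 //.
  exact: local_unit_neq0 (lam_unit O).
have ordT P : ord_at P (\det (T P)) =
    (ord_at P (origin_generator C true) + (count_mem P [:: O])%:Z) + ord_at P
      (lam O).
  have lam0 Q : lam Q != 0 := local_unit_neq0 (lam_unit Q).
  have ordL := ord_atM two_neq0 P (tau0 P) (lam0 O).
  have ordR := ord_atM two_neq0 P (lam0 P) (detT0 P).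
  rewrite -rel ordR (ord_at_unit two_neq0 (lam_unit P)) add0r in ordL.
  by rewrite ordL -ord_origin_generator.
rewrite /degree (eq_fsbigr (fun P => (ord_at P (origin_generator C true) +
  (count_mem P [:: O])%:Z) + ord_at P (lam O))); last by move=> P _;
    exact: ordT.
have fgen := finitely_supported_ord two_neq0 (gen0 true).
have flam := finitely_supported_ord two_neq0 (local_unit_neq0 (lam_unit O)).
have fO := finitely_supported_count [:: O].
rewrite sum_finitely_supportedD //; last exact: finitely_supportedD.
rewrite sum_finitely_supportedD // !sum_ord_eq0 //; last first.
  exact: local_unit_neq0 (lam_unit O).
by rewrite sum_count add0r addr0.
Qed.

End Degree.

(** * Saturation *)

Section Saturation.
Variables (k : closedFieldType) (C : elliptic_curve k).
Hypothesis two_neq0 : (2 : k) != 0.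
Local Notation K := (function_field C).
Local Notation O := (@origin k C).
Local Notation divisor_degree D := (\sum_(P \in [set: curve_point C]) D P).

Lemma cV_neq0P (F : nmodType) n (v : 'cV[F]_n) :
  v != 0 -> exists i, v i 0 != 0.
Proof.
move=> v0; apply: contrapT => nv; move/eqP: v0; apply; apply/matrixP => i j.
by rewrite ord1 mxE; apply: contrapT => /eqP vi; apply: nv; exists i.
Qed.

(** Take m to be the least order of a nonzero entry: dividing by z^m makes every entry regular and
    one of them a unit. *)
Lemma primitive_multiple P z n (v : 'cV[K]_n) : uniformizer P z -> v != 0 ->
  exists m : int, regular_mx_at P ((z ^ m)^-1 *: v) /\
    value_mx_at P ((z ^ m)^-1 *: v) != 0.
Proof.
move=> zu /cV_neq0P[i0 vi0]; have z0 := uniformizer_neq0 two_neq0 zu.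
have [i vi imin] := @arg_minP _ _ _ i0 (fun i => v i 0 != 0) (fun i =>
  ord_at P (v i 0)) vi0.
exists (ord_at P (v i 0)); set m := ord_at P _ in imin *.
have zm0 : (z ^ m)^-1 != 0 by rewrite invr_neq0 // expfz_neq0.
have ordz : ord_at P (z ^ m)^-1 = - m.
  rewrite (ord_atV two_neq0) ?expfz_neq0 // (ord_atXz two_neq0) //.
  by rewrite (ord_at_uniformizer two_neq0 zu) mulr1.
split=> [j l|].
  rewrite ord1 mxE; have [->|vj] := eqVneq (v j 0) 0.
    by rewrite mulr0; exact: regular0.
  apply: (ord_at_ge0_regular two_neq0); first by rewrite mulf_neq0.
  by rewrite (ord_atM two_neq0) // ordz addrC subr_ge0; exact: imin.
have vU : local_unit P ((z ^ m)^-1 * v i 0).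
  apply: (ord_at_eq0_unit two_neq0); first by rewrite mulf_neq0.
  by rewrite (ord_atM two_neq0) // ordz addNr.
apply/eqP => /matrixP/(_ i 0); rewrite !mxE => /eqP.
by rewrite (negPf vU.2).
Qed.

Lemma value_uniformizer_scale P z j n (v : 'cV[K]_n) :
  uniformizer P z -> regular_mx_at P v -> value_mx_at P (z ^+ j.+1 *: v) = 0.
Proof.
move=> [zP zv _] vP; rewrite value_mxZ //; last exact: regularX.
by rewrite exprS value_mul_eq0 ?scale0r //; exact: regularX.
Qed.

Lemma primitive_multiple_ge0 P z m n (v : 'cV[K]_n) : uniformizer P z ->
  regular_mx_at P v -> value_mx_at P ((z ^ m)^-1 *: v) != 0 -> 0 <= m.
Proof.
move=> zu vP; case: m => // j; rewrite -[z ^ _]/((z ^+ j.+1)^-1) invrK.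
by rewrite value_uniformizer_scale ?eqxx.
Qed.

Lemma primitive_multiple_eq0 P z m n (v : 'cV[K]_n) : uniformizer P z ->
  regular_mx_at P v -> regular_mx_at P ((z ^ m)^-1 *: v) ->
  value_mx_at P ((z ^ m)^-1 *: v) != 0 -> value_mx_at P v != 0 -> m = 0.
Proof.
move=> zu vP wP w0; have := primitive_multiple_ge0 zu vP w0;
  case: m wP w0 => // -[//|j] wP w0 _.
have z0 := uniformizer_neq0 two_neq0 zu.
have -> : v = z ^+ j.+1 *: ((z ^+ j.+1)^-1 *: v).
  by rewrite scalerA divff ?scale1r // expf_neq0.
by rewrite value_uniformizer_scale ?eqxx.
Qed.

Lemma regular_cofinite (f : K) :
  exists2 A : set (curve_point C), finite_set A & forall P, ~ A P ->
    regular_at P f.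
Proof.
have [->|f0] := eqVneq f 0; first by exists set0 => // P _; exact: regular0.
by have [A fA AP] := local_unit_cofinite two_neq0 f0; exists A => // P /AP[].
Qed.

Lemma regular_mx_cofinite n (v : 'cV[K]_n) :
  exists2 A : set (curve_point C), finite_set A & forall P, ~ A P ->
    regular_mx_at P v.
Proof.
pose A i := projT1 (cid2 (regular_cofinite (v i 0))).
have fA i : finite_set (A i) by rewrite /A; case: cid2.
have AP i P : ~ A i P -> regular_at P (v i 0) by rewrite /A; case: cid2 => B fB;
  exact.
exists (\bigcup_(i in [set: 'I_n]) A i).
  by apply: bigcup_finite => [|i _]; [exact: finite_finset | exact: fA].
by move=> P nP i j; rewrite ord1; apply: AP => iP; apply: nP; exists i.
Qed.

(** In the charts at the origin f is a single nonzero column. Off a finite set both charts are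
    defined, the column is regular and one of its entries is a unit. *)
Lemma fibre_mor_neq0_cofinite (L : bundle C 1) n (E : bundle C n)
  (f : bundle_mor L E) :
  nonzero_mor f -> finite_set [set P | fibre_mor f P = 0].
Proof.
move=> /(chart_mor_neq0 (chart_at E O) (chart_at L O));
  set v := mor_mx _ _ _ => v0.
have [i vi] := cV_neq0P v0.
have [A fA AP] := local_unit_cofinite two_neq0 vi.
have [B fB BP] := regular_mx_cofinite v.
apply: (@sub_finite_set _ _ (A `|` (B `|` (~` dom (chart_at E O) `|` ~` dom
  (chart_at L O))))).
  move=> P fP; apply: contrapT => /not_orP[/AP vU /not_orP[/BP vP /not_orP[]]].
  move=> /contrapT EP /contrapT LP; case: vU => _ /eqP; apply.
  have := mor_trans f (chart_at E O) (chart_at E P) (chart_at L P)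
    (chart_at L O).
  rewrite -/v => e.
  have rE : regular_mx_at P (trans (chart_at E O) (chart_at E P)).
    by apply: trans_regular => //; exact: dom_chart_at.
  have rL : regular_mx_at P (trans (chart_at L P) (chart_at L O)).
    by apply: trans_regular => //; exact: dom_chart_at.
  have rf := mor_mx_regular f P.
  have : value_mx_at P v = 0.
    rewrite -e !value_mxM //; last exact: regular_mxM.
    by move: fP; rewrite /= /fibre_mor => ->; rewrite mulmx0 mul0mx.
  by move=> /matrixP/(_ i 0); rewrite !mxE.
rewrite !finite_setU; split => //; split => //.
by split; exact: dom_open.
Qed.

(* The subbundle generated by the image of f, with the multiplicities m of the
   zeros of f. *)
Lemma saturation (L : bundle C 1) (E : bundle C 2) (f : bundle_mor L E) :
  nonzero_mor f -> exists (m : curve_point C -> int) (L' : bundle C 1)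
    (f' : bundle_mor L' E),
  [/\ finitely_supported m, forall P, 0 <= m P,
      degree L' = degree L + divisor_degree m, line_subbundle f' &
      forall P, m P = 0 -> fibre_mor f' P = fibre_mor f P].
Proof.
move=> f0; have [z zu] := choice (exists_uniformizer (C := C) two_neq0).
pose v P := mor_mx f (chart_at E P) (chart_at L P).
have v0 P : v P != 0 by exact: chart_mor_neq0.
have [m /all_and2[mP mv]] := choice (fun P => primitive_multiple (zu P) (v0 P)).
(* Where the fibre map is nonzero the column is already primitive, so m is 0 there. *)
have m_fin : finitely_supported m.
  apply: sub_finite_set (fibre_mor_neq0_cofinite f0) => P /= mP0.
  apply: contrapT => /eqP fP; move/eqP: mP0; apply.
  exact: primitive_multiple_eq0 (zu P) (mor_mx_regular f P) (mP P) (mv P) fP.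
have z0 P : z P ^ m P != 0 by rewrite expfz_neq0 // (uniformizer_neq0 two_neq0
  (zu P)).
have ordz P : ord_at P (z P ^ m P) = m P.
  rewrite (ord_atXz two_neq0) ?(uniformizer_neq0 two_neq0 (zu P)) //.
  by rewrite (ord_at_uniformizer two_neq0 (zu P)) mulr1.
exists m, (twist_bundle two_neq0 L m_fin z0 ordz),
  (twist_mor two_neq0 m_fin z0 ordz mP).
split => //.
- by move=> P; exact: primitive_multiple_ge0 (zu P) (mor_mx_regular f P) (mv P).
- exact: degree_twist.
- by move=> P m0; rewrite /fibre_mor /= /twist_mx m0 expr0z invr1 scale1r.
Qed.

(* Composition with the inclusion of L(- sum of the points of s) in L. *)
Lemma vanishing_twist (L : bundle C 1) n (E : bundle C n) (f : bundle_mor L E)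
    (s : seq (curve_point C)) : nonzero_mor f ->
  exists (L' : bundle C 1) (f' : bundle_mor L' E),
  [/\ degree L' = degree L - (size s)%:Z, nonzero_mor f',
      forall P, P \in s -> fibre_mor f' P = 0 &
      forall P, exists a, fibre_mor f' P = a *: fibre_mor f P].
Proof.
move=> f0; have [z zu] := choice (exists_uniformizer (C := C) two_neq0).
pose m P : int := - (count_mem P s)%:Z.
have m_fin : finitely_supported m.
  by apply: finitely_supportedN; exact: finitely_supported_count.
have z0 P : z P ^ m P != 0 by rewrite expfz_neq0 // (uniformizer_neq0 two_neq0
  (zu P)).
have ordz P : ord_at P (z P ^ m P) = m P.
  rewrite (ord_atXz two_neq0) ?(uniformizer_neq0 two_neq0 (zu P)) //.
  by rewrite (ord_at_uniformizer two_neq0 (zu P)) mulr1.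
have zmE P : (z P ^ m P)^-1 = z P ^+ count_mem P s by rewrite /m -invr_expz
  invrK.
have zmP P : regular_at P (z P ^ m P)^-1.
  by rewrite zmE; apply: regularX; have [] := zu P.
have mP P : regular_mx_at P ((z P ^ m P)^-1 *: mor_mx f (chart_at E P)
  (chart_at L P)).
  by apply: regular_mxZ => //; exact: mor_mx_regular.
exists (twist_bundle two_neq0 L m_fin z0 ordz),
  (twist_mor two_neq0 m_fin z0 ordz mP).
split.
- rewrite degree_twist; congr (_ + _); rewrite /m sum_finitely_supportedN.
    by rewrite sum_count.
  exact: finitely_supported_count.
- exists (chart_at E O), O; rewrite /= /twist_mx scaler_eq0 invr_eq0 (negPf
    (z0 O)).
  exact: chart_mor_neq0.
- move=> P; rewrite -has_pred1 has_count => sP;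
    rewrite /fibre_mor /= /twist_mx zmE.
  case: (count_mem P s) sP => // j _.
  by apply: value_uniformizer_scale => //; exact: mor_mx_regular.
- move=> P; exists (value_at P (z P ^ m P)^-1).
  by rewrite /fibre_mor /= /twist_mx value_mxZ //; exact: mor_mx_regular.
Qed.

End Saturation.

(** * Stability *)

(** The chamber is the set of weights in the open cube at l^1-distance less than 1 from the vertex
    equal to 1 on I and 0 elsewhere. Moving the weights to this vertex changes the weight part of
    the stability index by at most that distance and makes it an integer. *)
Lemma chamber_stability (R : realType) n (I J : {set 'I_n}) (mu : 'I_n -> R)
    (k : nat) (d : int) :
  weight_chamber I mu -> #|I| = (2 * k + 2)%N ->
  (1 - 2 * d%:~R + \sum_(j | j \notin J) mu j - \sum_(j in J) mu j < 0) =
  (#|I :\: J|%:Z <= k%:Z + d).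
Proof.
move=> [mu01 muI] cardI.
pose s j : R := if j \in J then - mu j else mu j.
pose e j : R := if j \in I then 1 - mu j else mu j.
(* The value of [s j] at this vertex; [e j] is the distance from [mu j] to the coordinate of the
   vertex. *)
pose c j : int := if j \in I then (if j \in J then -1 else 1) else 0.
have sE : \sum_(j | j \notin J) mu j - \sum_(j in J) mu j = \sum_j s j.
  rewrite -sumrN [in LHS]big_mkcond /= [X in _ + X]big_mkcond -big_split /=.
  by apply: eq_bigr => j _; rewrite /s; case: (j \in J); rewrite ?add0r ?addr0.
have eE : \sum_j e j < 1.
  suff -> : \sum_j e j = \sum_(j in ~: I) mu j - \sum_(j
    in I) mu j + #|I|%:R by [].
  rewrite -sumr_const -sumrN [X in X + _ + _]big_mkcond [X
    in _ + X + _]big_mkcond.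
  rewrite [X in _ + X]big_mkcond -!big_split /=.
  apply: eq_bigr => j _; rewrite /e inE; case: (j \in I) => /=;
    last by rewrite !addr0.
  by rewrite add0r addrC.
have cE : \sum_j c j = 2 * #|I :\: J|%:Z - (2 * k + 2)%N%:Z.
  rewrite -cardI -(cardsID J I).
  have -> : \sum_j c j = \sum_(j in I :\: J) 1 - \sum_(j in I :&: J) 1.
    rewrite -sumrN [X in _ = X + _]big_mkcond [X
      in _ = _ + X]big_mkcond -big_split /=.
    by apply: eq_bigr => j _; rewrite /c !inE; case: (j \in I); case: (j \in J).
  by rewrite !sumr_const; lia.
have bound : `|\sum_j s j - (\sum_j c j)%:~R| <= \sum_j e j.
  rewrite raddf_sum -sumrB; apply: (le_trans (ler_norm_sum _ _ _)).
  apply: ler_sum => j _; rewrite /s /c /e ler_norml.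
  have /andP[mu0 mu1] := mu01 j.
  by case: (j \in I); case: (j \in J) => /=; apply/andP; split; lra.
rewrite -addrA sE; have {bound} /ltr_normlP[lo hi] := le_lt_trans bound eE.
rewrite cE in lo hi; set S := \sum_j s j in lo hi *.
set m := #|I :\: J|%:Z in lo hi *.
have castE : (2 * m - (2 * k + 2)%N%:Z)%:~R = 2 * (m - k%:Z)%:~R - 2 :> R.
  by rewrite PoszD PoszM; rewrite !(intrB, intrD, intrM); ring.
rewrite castE in lo hi.
have [le|gt] := lerP m (k%:Z + d).
  have : (m - k%:Z)%:~R <= d%:~R :> R by rewrite ler_int; lia.
  lra.
have : d%:~R + 1 <= (m - k%:Z)%:~R :> R by rewrite -[1]/(1%:~R) -intrD ler_int;
  lia.
by move=> H; apply/negbTE; rewrite -leNgt; lra.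
Qed.

Section ParabolicBundles.
Variables (k : closedFieldType) (C : elliptic_curve k) (n : nat).
Variables (t : 'I_n -> curve_point C) (E : bundle C 2)
  (p : parabolic_structure t E).

Lemma line_subbundle_nonzero (L : bundle C 1) (f : bundle_mor L E) :
  line_subbundle f -> nonzero_mor f.
Proof.
move=> sub; exists (chart_at E origin), (chart_at L origin).
apply: contra_neq (sub origin) => f0; apply/matrixP => i j.
by rewrite !mxE f0 mxE value0.
Qed.

(** Once the fibre map is nonzero both subspaces are lines, so inclusion is equality. *)
Lemma passes_through_subbundle (L : bundle C 1) (f : bundle_mor L E) j :
  fibre_mor f (t j) != 0 ->
  passes_through p f j = (parabolic_line p j == fibre_image f (t j)).
Proof.
move=> f0; rewrite /passes_through eq_sym eqEdim dim_parabolic_line.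
by rewrite dim_vline f0 andbT.
Qed.

Lemma passes_through_scale (L L' : bundle C 1) (f : bundle_mor L E)
    (f' : bundle_mor L' E) j a : fibre_mor f' (t j) = a *: fibre_mor f (t j) ->
  passes_through p f j -> passes_through p f' j.
Proof.
rewrite /passes_through /fibre_image => ->; rewrite -!memvE => fj.
by rewrite memvZ.
Qed.
End ParabolicBundles.

Theorem lemma2p7 (R : realType) (C : elliptic_curve R[i])
    (n : nat) (t : 'I_n -> curve_point C) (t_inj : injective t)
    (I : {set 'I_n}) (k : nat) (card_I : #|I| = (2 * k + 2)%N)
    (mu : 'I_n -> R) (mu_I : weight_chamber I mu)
    (E1 : bundle C 2) (hE1 : is_E1 E1) (p : parabolic_structure t E1) :
  ~ semistable p mu <->
  exists (L : bundle C 1) (f : bundle_mor L E1),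
    [/\ degree L = - k%:Z, nonzero_mor f &
        forall j : 'I_n, j \in I -> passes_through p f j].
Proof.
have two_neq0 : (2 : R[i]) != 0 by rewrite pnatr_eq0.
have stabE L (f : bundle_mor L E1) (J := [set j | parabolic_line p j ==
  fibre_image f (t j)]%SET) :
    (stab p mu f < 0) = (#|I :\: J|%:Z <= k%:Z + degree L).
  rewrite -(chamber_stability J (degree L) mu_I card_I) /stab
    (degree_E1 two_neq0 hE1).
  by congr (_ + _ - _ < 0); apply: eq_bigl => j; rewrite inE.
split=> [/existsNP[L /existsNP[f]] | [L [f [degL f0 pass]]] ss].
  move=> /not_implyP[sub /negP]; rewrite -ltNge stabE; set J := finset _ => IJ.
  (* N copies of the origin, an arbitrary choice of point, fill the divisor up to degree k + d. *)
  have [N NE] : exists N : nat, k%:Z + degree L = #|I :\: J|%:Z + N%:Z.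
    by exists (absz (k%:Z + degree L - #|I :\: J|%:Z)%R); lia.
  have f0 := line_subbundle_nonzero sub.
  have [L' [f' [degL' f0' van scale]]] := vanishing_twist two_neq0
    (map t (enum (I :\: J)) ++ nseq N origin) f0.
  exists L', f'; split => //.
    by rewrite degL' size_cat size_map -cardE size_nseq PoszD -NE opprD addrCA
      subrr addr0.
  (* On J the fibre is already p_j and twisting only rescales it; off J the new map vanishes at
     t_j. *)
  move=> j Ij; have [Jj|nJj] := boolP (j \in J).
    have [a e] := scale (t j); apply: passes_through_scale e _.
    by rewrite passes_through_subbundle //; rewrite inE in Jj.
  rewrite /passes_through /fibre_image van.
    by rewrite -memvE mem0v.
  by rewrite mem_cat map_f // mem_enum inE nJj.
have [m [L' [f' [fin_m m_ge0 degL' sub same]]]] := saturation two_neq0 f0.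
have := ss L' f' sub; rewrite leNgt stabE; set J := finset _ => /negP; apply.
rewrite degL' degL addrA subrr add0r.
pose s := map t (enum (I :\: J)).
have -> : #|I :\: J|%:Z = (size s)%:Z by rewrite size_map -cardE.
(* Both sides become sums over the curve, compared point by point: m P is at least the multiplicity
   of P in s, which is at most 1 as t is injective. *)
rewrite -sum_count -subr_ge0.
have fs := finitely_supported_count s.
rewrite -sum_finitely_supportedN // -sum_finitely_supportedD //; last first.
  exact: finitely_supportedN.
apply: fsumr_ge0 => P _; rewrite subr_ge0 count_uniq_mem; last first.
  by rewrite map_inj_uniq // enum_uniq.
have [/mapP[j]|_] := boolP (P \in s); last exact: m_ge0.
rewrite mem_enum inE => /andP[nJ jI] ->.
(* If m were 0 at t_j, saturation would leave the fibre map there unchanged, and p_j would be the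
   fibre of the subbundle, contrary to j lying outside J. *)
have : m (t j) != 0.
  apply: contraNneq nJ => mj0; rewrite inE -passes_through_subbundle //.
  apply: (passes_through_scale (f := f) (a := 1)); last exact: pass.
  by rewrite scale1r; exact: same.
by have := m_ge0 (t j); lia.
Qed.
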